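(* Assume $0<\alpha<\frac12$. Then, when $i\to+\infty$, in probability (under $\mathbb{P}$), $$\frac{\overline{Z}_{\rho_i}}{i^{\frac{1}{1-\alpha}}}\longrightarrow \mathbf{c_1},\qquad\text{where } \mathbf{c_1}=(2(1-\alpha))^{1/(1-\alpha)}.$$
   Context: Let $\mathbb{Z}_+=\{0,1,2,\dots\}$ and $\alpha>0$. $Z=(Z_n)_{n\in\mathbb{N}}=((X_n,Y_n))_{n\in\mathbb{N}}$ is the nearest-neighbour Markov chain on $\mathbb{Z}_+^2$ with the following transition probabilities. At any $(x,y)$ with $xy\neq0$ it jumps to each of its four neighbours with probability $\frac14$. For every integer $i>0$: $p((i,0),(i+1,0))=p((0,i),(0,i+1))=1-\frac{1}{2i^{\alpha}}$, $p((i,0),(i,1))=p((0,i),(1,i))=\frac{1}{2i^{\alpha}}$, and $p((i,0),(i-1,0))=p((0,i),(0,i-1))=0$. From $(0,0)$ it jumps to $(1,0)$ or $(0,1)$ with probability $\frac12$ each. $\mathbb{P}$ denotes the law of the walk started at $(1,1)$. For $z=(x,y)$, $\overline{z}:=\max(x,y)$. Stopping times: $\rho_0:=0$ and for $i\ge1$, $\eta_i:=\inf\{k>\rho_{i-1}: X_kY_k=0\}$, $\rho_i:=\inf\{k>\eta_i: X_kY_k\neq0\}$. *)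

(* Defs.v *)
From HB Require Import structures.
From mathcomp Require Import all_boot all_order all_algebra.
From mathcomp Require Import all_classical all_reals all_analysis.
Set Implicit Arguments.
Unset Strict Implicit.
Unset Printing Implicit Defensive.
Import Order.TTheory GRing.Theory Num.Theory.
Import numFieldNormedType.Exports.
Local Open Scope classical_set_scope.
Local Open Scope ring_scope.

Definition state : Type := (nat * nat)%type.

(* [trans alpha z w] is the probability p(z, w) of a jump from z to w. *)
Definition trans (R : realType) (alpha : R) (z w : state) : R :=
  match z with
  | (0, 0) => if w \in [:: (1, 0); (0, 1)]%N then 2^-1 else 0
  | (i.+1, 0) =>
      if w == (i.+2, 0)%N then 1 - (2 * i.+1%:R `^ alpha)^-1
      else if w == (i.+1, 1)%N then (2 * i.+1%:R `^ alpha)^-1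
      else 0
  | (0, i.+1) =>
      if w == (0, i.+2)%N then 1 - (2 * i.+1%:R `^ alpha)^-1
      else if w == (1, i.+1)%N then (2 * i.+1%:R `^ alpha)^-1
      else 0
  | (x.+1, y.+1) =>
      if w \in [:: (x.+2, y.+1); (x, y.+1); (x.+1, y.+2); (x.+1, y)]%N
      then 4^-1 else 0
  end.

(* P(B | A); only meaningful when A has nonzero probability. *)
Definition cond_prob d (T : measurableType d) (R : realType)
    (P : probability T R) (B A : set T) : R :=
  fine (P (B `&` A)) / fine (P A).

Definition is_markov_chain d (T : measurableType d) (R : realType)
    (P : probability T R) (p : state -> state -> R) (z0 : state)
    (Z : nat -> {RV P >-> (nat * nat)%type}) : Prop :=
  P [set t | Z 0%N t = z0] = 1%E /\
  forall (n : nat) (z : nat -> state) (w : state),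
    let past := [set t | forall k, (k <= n)%N -> Z k t = z k] in
    P past != 0%E ->
    cond_prob P [set t | Z n.+1 t = w] past = p (z n) w.

Definition on_axes (z : state) : bool := (z.1 * z.2 == 0)%N.

(* A random time is an [option nat], with [None] for +oo: this is
   inf {k > t : A (z k)}, with inf of the empty set equal to +oo. *)
Definition next_hit (z : nat -> state) (A : pred state) (t : option nat) :
    option nat :=
  if t is Some s then
    if pselect (exists k, (s < k)%N && A (z k)) is left h
    then Some (ex_minn h) else None
  else None.

Fixpoint rho (z : nat -> state) (i : nat) : option nat :=
  if i is j.+1 then next_hit z (predC on_axes) (next_hit z on_axes (rho z j))
  else Some 0%N.

(* eta z i only matters for i >= 1. *)
Definition eta (z : nat -> state) (i : nat) : option nat :=
  next_hit z on_axes (rho z i.-1).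

Lemma rhoS (z : nat -> state) (i : nat) :
  rho z i.+1 = next_hit z (predC on_axes) (eta z i.+1).
Proof. by []. Qed.

Definition height (z : state) : nat := maxn z.1 z.2.

(* The height of the path at a random time, and 0 at time +oo. *)
Definition height_at (z : nat -> state) (t : option nat) : nat :=
  if t is Some k then height (z k) else 0%N.

Definition cvg_in_probability d (T : measurableType d) (R : realType)
    (P : probability T R) (X : nat -> T -> R) (l : R) : Prop :=
  forall eps : R, 0 < eps ->
    P [set t | eps < `|X n t - l|] @[n --> \oo] --> 0%E.

(* Main.v *)
Require Import Defs.
From HB Require Import structures.
From mathcomp Require Import all_boot all_order all_algebra.
From mathcomp Require Import all_classical all_reals all_analysis.
From mathcomp Require Import ring lra zify.
Set Implicit Arguments.
Unset Strict Implicit.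
Unset Printing Implicit Defensive.
Import Order.TTheory GRing.Theory Num.Theory.
Import numFieldNormedType.Exports.
Local Open Scope classical_set_scope.
Local Open Scope ring_scope.

(** Let [b = 1 - alpha], let [k] count the entries into the interior so far and
    put [v (x, y) = (x + y)^b / (2 b)] and
    [f (x, y) = (x^2 + y^2 + 1/2)^(b/4) / sqrt (2 b)], so that [v] and [f^2]
    agree up to a bounded error on the axes. In the interior [v] is
    superharmonic and [f] is subharmonic; on the axes both [v] and [k] increase
    at rate at most the exit probability [1 / (2 j^alpha)], while
    [2 f sqrt k] increases at asymptotically at least twice this rate, by
    AM-GM. Hence [v + k - 2 f sqrt k], corrected by [2 eps k + O(1)], is a
    supermartingale which dominates [(f - sqrt k)^2] up to [eps k + O(1)], and
    Chebyshev's inequality at the [N]-th entry gives [f ~ sqrt N]. That the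
    [N]-th entry happens almost surely follows from the strict negative drift
    of [sqrt (x + y) - 2 k]; this is where [alpha <= 1/2] matters. *)

(** For [f^2 + k - 2 f sqrt k] itself to be nearly a supermartingale, [f] would have to be
    subharmonic and [f^2] superharmonic. By Jensen's inequality a nonnegative subharmonic [f] has a
    subharmonic square, so [f^2] cannot serve; hence the second potential [v], with [f^2 <= v + 1]
    off the origin. The constant comes from [v]: at height [j] on an axis the exit probability is
    [1 / (2 j^alpha)], with integral [j^b / (2 b)]. One entry per unit of [v] puts the [N]-th entry
    at height about [(2 b N)^(1/b)]. The AM-GM bound holds whatever the ratio of [f] to [sqrt k], so
    the estimate calls for no a priori control of the height. Expectations occur only as iterates of
    a one-step operator on functions of the pair (position, number of entries), frozen at the [N]-th
    entry; a path argument bounds the probability of an event at a fixed time by such an iterate. *)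

(** * Convexity inequalities for real powers *)

(** Concavity of [ln]: its tangent at the weighted mean [m] of [x] and [1] bounds [ln x] and [ln 1];
    averaging with weights [p] and [1 - p] gives [p * ln x <= ln m]. *)
Lemma powR_bernoulli (R : realType) (x p : R) :
  0 < x -> 0 <= p <= 1 -> x `^ p <= p * x + (1 - p).
Proof.
move=> x0 /andP[p0 p1].
set m := p * x + (1 - p).
have m0 : 0 < m.
  rewrite /m; have [->|pn0] := eqVneq p 0; first by rewrite mul0r subr0 add0r.
  have : 0 < p * x by rewrite mulr_gt0// lt0r pn0.
  by move: p1; lra.
rewrite -ler_ln ?posrE ?powR_gt0// ln_powR.
have lnle (y : R) : 0 < y -> ln y - ln m <= y / m - 1.
  move=> y0; rewrite -ln_div ?posrE//.
  have ym : 0 < y / m by rewrite divr_gt0.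
  have -> : ln (y / m) = ln (1 + (y / m - 1)) by congr ln; ring.
  by apply: le_ln1Dx; lra.
have hx := lnle _ x0; have h1 := lnle _ (@ltr01 R).
rewrite ln1 in h1.
have h2 : p * (x / m) + (1 - p) * (1 / m) = 1.
  by rewrite mulrA mul1r -mulrDl divff// gt_eqF.
have := ler_wpM2l p0 hx.
have q0 : 0 <= 1 - p by rewrite subr_ge0.
have := ler_wpM2l q0 h1.
by move: h2; lra.
Qed.

Lemma powR_succ_le (R : realType) (x p : R) : 0 < x -> 0 <= p <= 1 ->
  (x + 1) `^ p <= x `^ p + p * x `^ (p - 1).
Proof.
move=> x0 hp.
have -> : x + 1 = x * (1 + x^-1) by field; rewrite gt_eqF.
have xi : 0 < x^-1 by rewrite invr_gt0.
have i0 : 0 <= 1 + x^-1 by lra.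
rewrite (powRM _ (ltW x0) i0).
have h : (1 + x^-1) `^ p <= p * (1 + x^-1) + (1 - p) by rewrite powR_bernoulli ?addr_gt0.
have := ler_wpM2l (powR_ge0 x p) h.
have -> : x `^ (p - 1) = x `^ p / x.
  by rewrite powRB ?(gt_eqF x0) ?implybT// powRr1 ?ltW.
by lra.
Qed.

Lemma powR_midpoint_concave (R : realType) (x p : R) : 1 < x -> 0 <= p <= 1 ->
  (x + 1) `^ p + (x - 1) `^ p <= 2 * x `^ p.
Proof.
move=> x1 hp; have x0 : 0 < x by lra.
have xi : 0 < x^-1 by rewrite invr_gt0.
have xi1 : x^-1 < 1 by rewrite invf_lt1.
have -> : x + 1 = x * (1 + x^-1) by field; rewrite gt_eqF.
have -> : x - 1 = x * (1 - x^-1) by field; rewrite gt_eqF.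
have i0 : 0 <= 1 + x^-1 by lra.
have j0 : 0 <= 1 - x^-1 by lra.
rewrite (powRM _ (ltW x0) i0) (powRM _ (ltW x0) j0).
have h1 : (1 + x^-1) `^ p <= p * (1 + x^-1) + (1 - p) by rewrite powR_bernoulli ?addr_gt0.
have h2 : (1 - x^-1) `^ p <= p * (1 - x^-1) + (1 - p) by rewrite powR_bernoulli ?subr_gt0.
have h : (1 + x^-1) `^ p + (1 - x^-1) `^ p <= 2 by lra.
by have := ler_wpM2l (powR_ge0 x p) h; lra.
Qed.

(** Convexity of the exponential: as a function of [ln y], the power [y ^ p] lies above its tangent
    at [ln s], and by hypothesis the four logarithms average at least [ln s]. *)
Lemma powR_amgm4 (R : realType) (a b c d s p : R) :
  0 < a -> 0 < b -> 0 < c -> 0 < d -> 0 < s -> 0 <= p ->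
  s ^+ 4 <= a * b * c * d ->
  4 * s `^ p <= a `^ p + b `^ p + c `^ p + d `^ p.
Proof.
move=> a0 b0 c0 d0 s0 p0 h.
have lnh : 4 * ln s <= ln a + ln b + ln c + ln d.
  rewrite -!lnM ?posrE ?mulr_gt0// mulr_natl -lnXn//.
  by rewrite ler_ln ?posrE ?mulr_gt0 ?exprn_gt0.
have key (y : R) : 0 < y -> s `^ p * (1 + p * (ln y - ln s)) <= y `^ p.
  move=> y0; rewrite /powR !gt_eqF//.
  have -> : expR (p * ln y) = expR (p * ln s) * expR (p * (ln y - ln s)).
    by rewrite -expRD; congr expR; ring.
  by rewrite ler_wpM2l ?expR_ge0// expR_ge1Dx.
have := key _ a0; have := key _ b0; have := key _ c0; have := key _ d0.
have : 0 <= s `^ p * (p * (ln a + ln b + ln c + ln d - 4 * ln s)).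
  by rewrite mulr_ge0 ?powR_ge0// mulr_ge0// subr_ge0.
by lra.
Qed.

(** * The transition kernel as a weighted sum over neighbours *)

Definition exit_prob (R : realType) (alpha : R) (j : nat) : R :=
  (2 * j%:R `^ alpha)^-1.

Definition nbrs (z : state) : seq state :=
  match z with
  | (0, 0) => [:: (1, 0); (0, 1)]%N
  | (i.+1, 0) => [:: (i.+2, 0); (i.+1, 1)]%N
  | (0, i.+1) => [:: (0, i.+2); (1, i.+1)]%N
  | (x.+1, y.+1) => [:: (x.+2, y.+1); (x, y.+1); (x.+1, y.+2); (x.+1, y)]%N
  end.

Lemma nbrs_uniq (z : state) : uniq (nbrs z).
Proof.
by case: z => [[|x] [|y]] //=; rewrite !inE !xpair_eqE /=; lia.
Qed.

Lemma on_axes0l (j : nat) : on_axes (0, j)%N.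
Proof. by rewrite /on_axes /= mul0n. Qed.

Lemma on_axes0r (j : nat) : on_axes (j, 0)%N.
Proof. by rewrite /on_axes /= muln0. Qed.

Lemma on_axes_inner (x y : nat) : on_axes (x.+1, y.+1) = false.
Proof. by []. Qed.

Lemma exit_prob_gt0 (R : realType) (alpha : R) (j : nat) :
  0 < exit_prob alpha j.+1.
Proof. by rewrite invr_gt0 mulr_gt0// powR_gt0 ?ltr0n. Qed.

Lemma exit_prob_le12 (R : realType) (alpha : R) (j : nat) : 0 <= alpha ->
  exit_prob alpha j.+1 <= 2^-1.
Proof.
move=> a0; have h : 1 <= j.+1%:R `^ alpha :> R.
  by rewrite -[leLHS](powRr0 j.+1%:R) ler_powR// ler1n.
by rewrite /exit_prob lef_pV2 ?posrE; lra.
Qed.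

Lemma trans_sum_inner (R : realType) (alpha : R) (g : state -> R) (x y : nat) :
  \sum_(w <- nbrs (x.+1, y.+1)) trans alpha (x.+1, y.+1) w * g w =
  4^-1 * (g (x.+2, y.+1) + g (x, y.+1) + g (x.+1, y.+2) + g (x.+1, y)).
Proof. by rewrite !big_cons big_nil /= !inE !eqxx !orbT /=; ring. Qed.

Lemma trans_sum_axis1 (R : realType) (alpha : R) (g : state -> R) (j : nat) :
  \sum_(w <- nbrs (j.+1, 0)%N) trans alpha (j.+1, 0)%N w * g w =
  (1 - exit_prob alpha j.+1) * g (j.+2, 0)%N
    + exit_prob alpha j.+1 * g (j.+1, 1)%N.
Proof.
rewrite !big_cons big_nil /= !eqxx addr0.
by have -> : ((j.+1, 1) == (j.+2, 0))%N = false by rewrite xpair_eqE andbF.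
Qed.

Lemma trans_sum_axis2 (R : realType) (alpha : R) (g : state -> R) (j : nat) :
  \sum_(w <- nbrs (0, j.+1)%N) trans alpha (0, j.+1)%N w * g w =
  (1 - exit_prob alpha j.+1) * g (0, j.+2)%N
    + exit_prob alpha j.+1 * g (1, j.+1)%N.
Proof. by rewrite !big_cons big_nil /= !eqxx addr0. Qed.

Lemma trans_sum1 (R : realType) (alpha : R) (z : state) :
  \sum_(w <- nbrs z) trans alpha z w = 1.
Proof.
have -> : \sum_(w <- nbrs z) trans alpha z w =
    \sum_(w <- nbrs z) trans alpha z w * (fun=> 1) w.
  by apply: eq_bigr => w _; rewrite mulr1.
case: z => [[|x] [|y]]; rewrite ?trans_sum_inner ?trans_sum_axis1 ?trans_sum_axis2.
- by rewrite !big_cons big_nil /=; field.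
- by ring.
- by ring.
- by field.
Qed.

Lemma trans_ge0 (R : realType) (alpha : R) (z w : state) : 0 <= alpha ->
  0 <= trans alpha z w.
Proof.
move=> a0.
have h1 i := ltW (exit_prob_gt0 alpha i).
have h2 i := exit_prob_le12 i a0.
have h3 i : 0 <= 1 - exit_prob alpha i.+1 by have := h2 i; lra.
by case: z => [[|x] [|y]] /=; repeat case: ifP => _ //;
  rewrite ?invr_ge0 ?h3//; exact: h1.
Qed.

(** * The one-step operator on pairs (position, number of entries) *)

Definition estep (e : state * nat) (w : state) : state * nat :=
  (w, (e.2 + (on_axes e.1 && ~~ on_axes w))%N).

(* One step of the pair (position, number of entries into the interior), frozen
   at the [N]-th entry, acting on functions. *)
Definition transfer (R : realType) (alpha : R) (N : nat)
    (f : state * nat -> R) (e : state * nat) : R :=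
  if (e.2 < N)%N then \sum_(w <- nbrs e.1) trans alpha e.1 w * f (estep e w)
  else f e.

(** An invariant of the walk from [(1, 1)]. Axis moves never go towards the origin and no interior
    point is adjacent to it, so the potentials need estimates only away from it. *)
Definition reachable (N : nat) (e : state * nat) : bool :=
  (e.1 != (0, 0)%N) && (e.2 <= N)%N.

Lemma reachable_estep (N : nat) (e : state * nat) (w : state) :
  reachable N e -> (e.2 < N)%N -> w \in nbrs e.1 -> reachable N (estep e w).
Proof.
case: e => [[x y] k]; rewrite /reachable /estep /= => /andP[z0 kN] kltN wn.
apply/andP; split; last by case: (_ && _) => /=; lia.
by case: x y z0 wn => [|x] [|y] //= _; rewrite !inE => h;
  apply/eqP => w0; move: h; rewrite w0 !xpair_eqE; lia.
Qed.

Lemma transfer_le (R : realType) (alpha : R) (N : nat)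
    (f g : state * nat -> R) (e : state * nat) : 0 <= alpha ->
  (forall e', reachable N e' -> f e' <= g e') -> reachable N e ->
  transfer alpha N f e <= transfer alpha N g e.
Proof.
move=> a0 fg re; rewrite /transfer; case: ifP => kN; last exact: fg.
rewrite big_seq [leRHS]big_seq ler_sum// => w wn.
by rewrite ler_wpM2l ?trans_ge0// fg ?reachable_estep.
Qed.

Lemma iter_transfer_le (R : realType) (alpha : R) (N n : nat)
    (f g : state * nat -> R) (e : state * nat) : 0 <= alpha ->
  (forall e', reachable N e' -> f e' <= g e') -> reachable N e ->
  iter n (transfer alpha N) f e <= iter n (transfer alpha N) g e.
Proof.
move=> a0 fg; elim: n e => [|n IH] e re /=; first exact: fg.
exact: transfer_le.
Qed.

Lemma transfer_lin (R : realType) (alpha : R) (N : nat) (a b : R)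
    (f g : state * nat -> R) (e : state * nat) :
  transfer alpha N (fun e => a * f e + b * g e) e =
  a * transfer alpha N f e + b * transfer alpha N g e.
Proof.
rewrite /transfer; case: ifP => // _; rewrite !mulr_sumr -big_split /=.
by apply: eq_bigr => w _; ring.
Qed.

Lemma iter_transfer_lin (R : realType) (alpha : R) (N n : nat) (a b : R)
    (f g : state * nat -> R) (e : state * nat) :
  iter n (transfer alpha N) (fun e => a * f e + b * g e) e =
  a * iter n (transfer alpha N) f e + b * iter n (transfer alpha N) g e.
Proof.
elim: n e => //= n IH e.
by rewrite (funext IH) transfer_lin.
Qed.

Lemma iter_transfer_cst (R : realType) (alpha : R) (N n : nat) (c : R)
    (e : state * nat) :
  iter n (transfer alpha N) (fun=> c) e = c.
Proof.
elim: n e => //= n IH e; rewrite (funext IH) /transfer; case: ifP => // _.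
by rewrite -mulr_suml trans_sum1 mul1r.
Qed.

Lemma iter_transfer_super (R : realType) (alpha : R) (N n : nat)
    (f : state * nat -> R) (e : state * nat) : 0 <= alpha ->
  (forall e', reachable N e' -> transfer alpha N f e' <= f e') ->
  reachable N e ->
  iter n (transfer alpha N) f e <= f e.
Proof.
move=> a0 hf re; elim: n => [//|n IH].
by rewrite iterSr; apply: le_trans IH; apply: iter_transfer_le.
Qed.

(** Telescoping, as in Dynkin's formula: for nonnegative [f], the total expected drift is bounded by
    the initial value, uniformly in [n]. *)
Lemma iter_transfer_drift (R : realType) (alpha : R) (N n : nat)
    (f g : state * nat -> R) (e : state * nat) : 0 <= alpha ->
  (forall e', reachable N e' -> transfer alpha N f e' <= f e' - g e') ->
  reachable N e ->
  iter n (transfer alpha N) f e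
    + \sum_(m < n) iter m (transfer alpha N) g e <= f e.
Proof.
move=> a0 hf re; elim: n => [|n IH]; first by rewrite big_ord0 addr0.
rewrite big_ord_recr /= -iterS iterSr.
have := iter_transfer_le n a0 hf re.
have -> : (fun e' => f e' - g e') = (fun e' => 1 * f e' + (-1) * g e').
  by apply: funext => e'; ring.
by rewrite iter_transfer_lin; move: IH; lra.
Qed.

(** * The [N]-th entry happens almost surely *)

(** Squaring reduces the claim to [sqrt ((x + 1) * (x - 1)) <= x - 1 / (2 x)]. The true gap is of
    order [x^(-3/2)]; any gap bounded below on bounded sets would do. *)
Lemma sqrt_midpoint (R : realType) (x : R) : 1 <= x ->
  Num.sqrt (x + 1) + Num.sqrt (x - 1) <= 2 * Num.sqrt x - (4 * x ^+ 2)^-1.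
Proof.
move=> x1; have x0 : 0 < x by lra.
set a := Num.sqrt (x + 1); set b := Num.sqrt (x - 1); set s := Num.sqrt x.
have a2 : a ^+ 2 = x + 1 by rewrite sqr_sqrtr//; lra.
have b2 : b ^+ 2 = x - 1 by rewrite sqr_sqrtr//; lra.
have s2 : s ^+ 2 = x by rewrite sqr_sqrtr//; lra.
have a0 : 0 <= a by exact: sqrtr_ge0.
have b0 : 0 <= b by exact: sqrtr_ge0.
have s1 : 1 <= s by rewrite -sqrtr1 ler_sqrt//; lra.
set u := x^-1; have u0 : 0 < u by rewrite invr_gt0.
have ux : u * x = 1 by rewrite mulVf// gt_eqF.
have u1 : u <= 1 by rewrite invf_le1.
have -> : (4 * x ^+ 2)^-1 = u ^+ 2 / 4 by rewrite /u; field; rewrite gt_eqF.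
have ab : a * b <= x - u / 2.
  rewrite -(@ler_pXn2r _ 2)// ?nnegrE; last 2 first.
  - by rewrite mulr_ge0.
  - lra.
  rewrite exprMn a2 b2.
  have -> : (x - u / 2) ^+ 2 = x ^+ 2 - u * x + u ^+ 2 / 4 by field.
  by rewrite ux; have := sqr_ge0 u; lra.
have us : u ^+ 2 * s <= u.
  have sx : s <= x by rewrite -s2 expr2; nra.
  have uux : u ^+ 2 * x = u by rewrite expr2 -mulrA ux mulr1.
  by rewrite -[leRHS]uux ler_wpM2l ?sqr_ge0.
have u2 : u ^+ 2 <= 1 by rewrite expr_le1// ltW.
rewrite -(@ler_pXn2r _ 2)// ?nnegrE; last 2 first.
- by rewrite addr_ge0.
- lra.
have -> : (a + b) ^+ 2 = a ^+ 2 + b ^+ 2 + 2 * (a * b) by ring.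
have -> : (2 * s - u ^+ 2 / 4) ^+ 2 = 4 * s ^+ 2 - u ^+ 2 * s + (u ^+ 2 / 4) ^+ 2.
  by field.
rewrite a2 b2 s2; have := sqr_ge0 (u ^+ 2 / 4).
by move: ab us; lra.
Qed.

Lemma sqrt_succ_le (R : realType) (x : R) : 0 < x ->
  Num.sqrt (x + 1) <= Num.sqrt x + (2 * Num.sqrt x)^-1.
Proof.
move=> x0; set s := Num.sqrt x.
have s0 : 0 < s by rewrite sqrtr_gt0.
have s2 : s ^+ 2 = x by rewrite sqr_sqrtr// ltW.
have i0 : 0 < (2 * s)^-1 by rewrite invr_gt0 mulr_gt0.
rewrite -(@ler_pXn2r _ 2)// ?nnegrE ?sqrtr_ge0//; last by rewrite addr_ge0// ltW.
rewrite sqr_sqrtr; last by lra.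
have -> : (s + (2 * s)^-1) ^+ 2 = s ^+ 2 + 1 + ((2 * s)^-1) ^+ 2.
  by field; rewrite gt_eqF.
by rewrite s2 lerDl sqr_ge0.
Qed.

(** The term [2 N] makes it nonnegative on reachable pairs, where [k <= N]. *)
Definition sqrt_potential (R : realType) (N : nat) (e : state * nat) : R :=
  Num.sqrt (e.1.1 + e.1.2)%:R - 2 * e.2%:R + 2 * N%:R.

(** Half of the gap in [sqrt_midpoint]: in the interior [x + y] moves up or down with probability
    [1/2] each. *)
Definition sqrt_drift (R : realType) (N : nat) (e : state * nat) : R :=
  if (e.2 < N)%N then (8 * (e.1.1 + e.1.2)%:R ^+ 2)^-1 else 0.

Lemma sqrt_drift_ge0 (R : realType) (N : nat) (e : state * nat) :
  0 <= sqrt_drift R N e.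
Proof.
by rewrite /sqrt_drift; case: ifP => // _; rewrite invr_ge0 mulr_ge0 ?sqr_ge0.
Qed.

(** Both axis moves raise [x + y] by one, which gains at most [1 / (2 sqrt x)]; an entry costs [2],
    hence [x^(-alpha) >= x^(-1/2)] on average. *)
Lemma axis_sqrt_drift (R : realType) (alpha : R) (j : nat) :
  alpha <= 2^-1 ->
  Num.sqrt j.+2%:R - 2 * exit_prob alpha j.+1 <=
  Num.sqrt j.+1%:R - (8 * j.+1%:R ^+ 2)^-1 :> R.
Proof.
move=> a12; set x : R := j.+1%:R.
have x1 : 1 <= x by rewrite ler1n.
have x0 : 0 < x by lra.
have -> : j.+2%:R = x + 1 :> R by rewrite -natr1.
set s := Num.sqrt x.
have s1 : 1 <= s by rewrite -sqrtr1 ler_sqrt//; lra.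
have s2 : s ^+ 2 = x by rewrite sqr_sqrtr//; lra.
have := sqrt_succ_le x0; rewrite -/s => h.
have h1 : x `^ alpha <= s by rewrite /s -(powR12_sqrt (ltW x0)) ler_powR.
have h2 : s^-1 <= 2 * exit_prob alpha j.+1.
  rewrite /exit_prob -/x invfM mulrA divff ?pnatr_eq0// mul1r.
  by rewrite lef_pV2 ?posrE ?powR_gt0//; lra.
have h3 : (8 * x ^+ 2)^-1 <= (2 * s)^-1.
  rewrite lef_pV2 ?posrE; last 2 first.
  - by rewrite mulr_gt0// exprn_gt0.
  - by lra.
  by rewrite -s2; nra.
have h4 : (2 * s)^-1 = s^-1 / 2 by field; lra.
move: h h2 h3; rewrite h4.
move: (Num.sqrt (x + 1)) s^-1 (8 * x ^+ 2)^-1 => p q r.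
by lra.
Qed.

Lemma transfer_sqrt_potential (R : realType) (alpha : R) (N : nat)
    (e : state * nat) : alpha <= 2^-1 ->
  reachable N e ->
  transfer alpha N (@sqrt_potential R N) e <= sqrt_potential R N e - sqrt_drift R N e.
Proof.
move=> a12; rewrite /transfer /sqrt_drift; case: ifP => kN; last by rewrite subr0.
case: e kN => [[[|x] [|y]] k] kN re //.
- rewrite trans_sum_axis2 /sqrt_potential /estep /= !add0n addn0 add1n.
  rewrite [(k + _)%N]addn1 -[k.+1%:R]natr1.
  have := @axis_sqrt_drift R alpha y a12.
  by move: (_^-1) (exit_prob _ _) (Num.sqrt _) (Num.sqrt _) => p q r t; lra.
- rewrite trans_sum_axis1 /sqrt_potential /estep !on_axes0r on_axes_inner /=.
  rewrite !addn0 !addn1 -[k.+1%:R]natr1.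
  have := @axis_sqrt_drift R alpha x a12.
  by move: (_^-1) (exit_prob _ _) (Num.sqrt _) (Num.sqrt _) => p q r t; lra.
rewrite trans_sum_inner /sqrt_potential /estep /= !addn0.
have := @sqrt_midpoint R (x + y).+2%:R.
have -> : (x + y).+2%:R + 1 = (x + y).+3%:R :> R by rewrite natr1.
have -> : (x + y).+2%:R - 1 = (x + y).+1%:R :> R by rewrite -natr1 addrK.
have -> : (x.+2 + y.+1 = (x + y).+3)%N by lia.
have -> : (x.+1 + y.+2 = (x + y).+3)%N by lia.
have -> : (x.+1 + y.+1 = (x + y).+2)%N by lia.
have -> : (x + y.+1 = (x + y).+1)%N by lia.
have -> : (x.+1 + y = (x + y).+1)%N by lia.
rewrite ler1n => /(_ isT).
set u : R := _ ^+ 2 => h.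
have h1 : (8 * u)^-1 = (4 * u)^-1 / 2 by rewrite -invfM; congr (_^-1); ring.
move: h; rewrite h1; move: (Num.sqrt _) (Num.sqrt _) (Num.sqrt _) (4 * u)^-1 => p q r t.
by lra.
Qed.

Definition running (R : realType) (N : nat) (e : state * nat) : R :=
  (e.2 < N)%N%:R.

Lemma iter_transfer_running_anti (R : realType) (alpha : R) (N n m : nat)
    (e : state * nat) : 0 <= alpha ->
  reachable N e -> (m <= n)%N ->
  iter n (transfer alpha N) (@running R N) e <=
  iter m (transfer alpha N) (@running R N) e.
Proof.
move=> a0 re /subnK <-; rewrite addnC iterD.
apply: iter_transfer_le => // e' re'; apply: iter_transfer_super => // e1 _.
rewrite /transfer /running; case: ifP => [_|->] //=.
rewrite -[leRHS](trans_sum1 alpha e1.1) ler_sum// => w _.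
by rewrite -[leRHS]mulr1 ler_wpM2l ?trans_ge0// lern1; case: (_ < _)%N.
Qed.

(** For [x + y <= L] the drift is at least [1 / (8 L^2)]; beyond [L] the potential exceeds
    [sqrt L]. *)
Lemma running_bound (R : realType) (N L : nat) (e : state * nat) :
  (0 < L)%N -> reachable N e ->
  running R N e <=
  8 * L%:R ^+ 2 * sqrt_drift R N e + (Num.sqrt L%:R)^-1 * sqrt_potential R N e.
Proof.
move=> L0 /andP[z0 kN].
have k0 : 0 <= 2 * (N%:R - e.2%:R) :> R by rewrite mulr_ge0// subr_ge0 ler_nat.
have s0 : 0 <= Num.sqrt (e.1.1 + e.1.2)%:R :> R by exact: sqrtr_ge0.
have sL : 0 < Num.sqrt L%:R :> R by rewrite sqrtr_gt0 ltr0n.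
have U0 : Num.sqrt (e.1.1 + e.1.2)%:R <= sqrt_potential R N e.
  by rewrite /sqrt_potential; lra.
have V0 : 0 <= (Num.sqrt L%:R)^-1 * sqrt_potential R N e.
  by rewrite mulr_ge0 ?invr_ge0 ?(ltW sL)//; lra.
rewrite /running /sqrt_drift; case: ifP => hk /=; last by rewrite mulr0 add0r.
have W0 : (0 < e.1.1 + e.1.2)%N.
  by case: e {kN k0 s0 U0 V0 hk} z0 => [[[|x] [|y]] k].
set W : R := (e.1.1 + e.1.2)%:R.
have W1 : 0 < W by rewrite ltr0n.
have [WL|LW] := leqP (e.1.1 + e.1.2) L.
  have : 1 <= 8 * L%:R ^+ 2 / (8 * W ^+ 2).
    rewrite ler_pdivlMr ?mul1r ?ler_pM2l ?mulr_gt0 ?exprn_gt0//.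
    by rewrite ler_pXn2r ?nnegrE// ler_nat.
  by lra.
have : 1 <= (Num.sqrt L%:R)^-1 * sqrt_potential R N e.
  rewrite ler_pdivlMl// mulr1; apply: le_trans U0.
  by rewrite ler_sqrt ?ler_nat ?ltr0n// ltnW.
have : 0 <= 8 * L%:R ^+ 2 / (8 * W ^+ 2).
  by rewrite divr_ge0 ?mulr_ge0 ?sqr_ge0.
by lra.
Qed.

(** The iterates decrease in [n], so the [n]-th is at most the average of the earlier ones. The
    total drift being at most [U], this average is at most [8 L^2 U / n + U / sqrt L]; [L] and then
    [n] make each term at most [delta / 2]. *)
Lemma running_vanishes (R : realType) (alpha : R) (N : nat) (e : state * nat)
    (delta : R) : 0 <= alpha -> alpha <= 2^-1 -> 0 < delta ->
  reachable N e ->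
  exists n, iter n (transfer alpha N) (@running R N) e <= delta.
Proof.
move=> a0 a12 d0 re.
set U := sqrt_potential R N e.
have U0 : 0 <= U.
  move: re => /andP[_ kN]; rewrite /U /sqrt_potential.
  have : 0 <= Num.sqrt (e.1.1 + e.1.2)%:R :> R by exact: sqrtr_ge0.
  have : e.2%:R <= N%:R :> R by rewrite ler_nat.
  by lra.
have drift e' (re' : reachable N e') := transfer_sqrt_potential a12 re'.
have bd m L : (0 < L)%N -> iter m (transfer alpha N) (@running R N) e <=
    8 * L%:R ^+ 2 * iter m (transfer alpha N) (@sqrt_drift R N) e
    + (Num.sqrt L%:R)^-1 * U.
  move=> L0.
  apply: le_trans (iter_transfer_le m a0 (fun e' => @running_bound R N L e' L0) re) _.
  rewrite iter_transfer_lin lerD2l ler_wpM2l ?invr_ge0 ?sqrtr_ge0//.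
  apply: iter_transfer_super => // e' re'; apply: le_trans (drift _ re') _.
  by rewrite lerBlDr lerDl sqrt_drift_ge0.
pose L := (Num.truncn ((2 * U / delta) ^+ 2)).+1.
have hL : (Num.sqrt L%:R)^-1 * U <= delta / 2.
  have hs : 0 < Num.sqrt L%:R :> R by rewrite sqrtr_gt0 ltr0n.
  rewrite ler_pdivrMl//.
  have : 2 * U / delta <= Num.sqrt L%:R.
    rewrite -(@ler_pXn2r _ 2)// ?nnegrE ?sqrtr_ge0//; last first.
      by rewrite divr_ge0 ?mulr_ge0// ltW.
    by rewrite [leRHS]sqr_sqrtr//; exact/ltW/truncnS_gt.
  by rewrite ler_pdivrMr//; lra.
pose n := (Num.truncn (16 * L%:R ^+ 2 * U / delta)).+1.
exists n.
have n0 : 0 < n%:R :> R by rewrite ltr0n.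
have hn : 8 * L%:R ^+ 2 * U <= n%:R * (delta / 2).
  have : 16 * L%:R ^+ 2 * U / delta <= n%:R by exact/ltW/truncnS_gt.
  by rewrite ler_pdivrMr//; lra.
rewrite -(ler_pM2l n0).
have -> : n%:R * iter n (transfer alpha N) (@running R N) e =
    \sum_(m < n) iter n (transfer alpha N) (@running R N) e.
  by rewrite sumr_const card_ord mulr_natl.
apply: (@le_trans _ _ (\sum_(m < n) (8 * L%:R ^+ 2 *
    iter m (transfer alpha N) (@sqrt_drift R N) e + (Num.sqrt L%:R)^-1 * U))).
  apply: ler_sum => m _.
  by apply: le_trans (bd m L isT); apply: iter_transfer_running_anti => //; exact/ltnW.
rewrite big_split /= -mulr_sumr sumr_const card_ord -mulr_natl.
have Un : 0 <= iter n (transfer alpha N) (@sqrt_potential R N) e.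
  rewrite -[leLHS](iter_transfer_cst alpha N n 0 e).
  apply: iter_transfer_le => // e' /andP[_ kN]; rewrite /sqrt_potential.
  have : 0 <= Num.sqrt (e'.1.1 + e'.1.2)%:R :> R by exact: sqrtr_ge0.
  have : e'.2%:R <= N%:R :> R by rewrite ler_nat.
  by lra.
have := iter_transfer_drift n a0 drift re; rewrite -/U => hsum.
have : 8 * L%:R ^+ 2 * \sum_(m < n) iter m (transfer alpha N) (@sqrt_drift R N) e
    <= 8 * L%:R ^+ 2 * U by rewrite ler_wpM2l ?mulr_ge0 ?sqr_ge0//; lra.
have := ler_wpM2l (ltW n0) hL.
by lra.
Qed.

(** * The potentials [v] and [f] *)

(** With a shift [c] and [s = x^2 + y^2 + c], the product over the four neighbours is [s^4 + (4 c -
    2) s^2 + 8 c s + 1 + 4 c + 16 x^2 y^2]; [c = 1/2] is the least shift with no negative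
    coefficient. *)
Definition rad2 (R : realType) (z : state) : R :=
  z.1%:R ^+ 2 + z.2%:R ^+ 2 + 2^-1.

Definition vpot (R : realType) (alpha : R) (z : state) : R :=
  (z.1 + z.2)%:R `^ (1 - alpha) / (2 * (1 - alpha)).

Definition fpot (R : realType) (alpha : R) (z : state) : R :=
  rad2 R z `^ ((1 - alpha) / 4) / Num.sqrt (2 * (1 - alpha)).

Lemma rad2_gt0 (R : realType) (z : state) : 0 < rad2 R z.
Proof.
by rewrite /rad2 addrC ltr_wpDr// addr_ge0// sqr_ge0.
Qed.

Lemma vpot_swap (R : realType) (alpha : R) (x y : nat) :
  vpot alpha (x, y) = vpot alpha (y, x).
Proof. by rewrite /vpot /= addnC. Qed.

Lemma fpot_swap (R : realType) (alpha : R) (x y : nat) :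
  fpot alpha (x, y) = fpot alpha (y, x).
Proof. by rewrite /fpot /rad2 /= [_ ^+ 2 + _ ^+ 2]addrC. Qed.

Lemma fpot_gt0 (R : realType) (alpha : R) (z : state) : alpha < 1 ->
  0 < fpot alpha z.
Proof.
move=> a1; have b0 : 0 < 1 - alpha by lra.
by rewrite /fpot divr_gt0 ?powR_gt0 ?rad2_gt0// sqrtr_gt0 mulr_gt0.
Qed.

(** The geometric mean of [rad2] over the four neighbours is at least its value at the centre, and
    [powR_amgm4] passes this on to powers. *)
Lemma fpot_inner (R : realType) (alpha : R) (x y : nat) : alpha < 1 ->
  4 * fpot alpha (x.+1, y.+1) <= fpot alpha (x.+2, y.+1) + fpot alpha (x, y.+1)
    + fpot alpha (x.+1, y.+2) + fpot alpha (x.+1, y).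
Proof.
move=> a1; have b0 : 0 <= (1 - alpha) / 4 by lra.
rewrite /fpot -!mulrDl mulrA ler_wpM2r ?invr_ge0 ?sqrtr_ge0//.
apply: powR_amgm4; rewrite ?rad2_gt0// /rad2 /=.
rewrite -(natr1 x.+1) -(natr1 y.+1) -(natr1 x) -(natr1 y).
set u : R := x%:R; set v : R := y%:R.
have -> : (((u + 1 + 1) ^+ 2 + (v + 1) ^+ 2 + 2^-1) *
    (u ^+ 2 + (v + 1) ^+ 2 + 2^-1) *
    ((u + 1) ^+ 2 + (v + 1 + 1) ^+ 2 + 2^-1) *
    ((u + 1) ^+ 2 + v ^+ 2 + 2^-1)) =
    ((u + 1) ^+ 2 + (v + 1) ^+ 2 + 2^-1) ^+ 4 +
    (4 * ((u + 1) ^+ 2 + (v + 1) ^+ 2 + 2^-1) + 3 +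
      16 * ((u + 1) ^+ 2 * (v + 1) ^+ 2)) by field.
by rewrite lerDl !addr_ge0 ?mulr_ge0 ?addr_ge0 ?sqr_ge0.
Qed.

(** In the interior [x + y] is a simple random walk, and [v] is a concave function of it. *)
Lemma vpot_inner (R : realType) (alpha : R) (x y : nat) :
  0 <= alpha -> alpha < 1 ->
  vpot alpha (x.+2, y.+1) + vpot alpha (x, y.+1)
    + vpot alpha (x.+1, y.+2) + vpot alpha (x.+1, y) <=
  4 * vpot alpha (x.+1, y.+1).
Proof.
move=> a0 a1; have b0 : 0 < 1 - alpha by lra.
rewrite /vpot /= -!mulrDl mulrA ler_wpM2r ?invr_ge0 ?mulr_ge0 ?(ltW b0)//.
have -> : (x.+2 + y.+1 = (x + y).+3)%N by lia.
have -> : (x.+1 + y.+2 = (x + y).+3)%N by lia.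
have -> : (x.+1 + y.+1 = (x + y).+2)%N by lia.
have -> : (x + y.+1 = (x + y).+1)%N by lia.
have -> : (x.+1 + y = (x + y).+1)%N by lia.
have x1 : 1 < (x + y).+2%:R :> R by rewrite ltr1n.
have hp : 0 <= 1 - alpha <= 1 by apply/andP; split; lra.
have := powR_midpoint_concave x1 hp.
have -> : (x + y).+2%:R + 1 = (x + y).+3%:R :> R by rewrite natr1.
have -> : (x + y).+2%:R - 1 = (x + y).+1%:R :> R by rewrite -natr1 addrK.
by lra.
Qed.

(** [exit_prob] is the derivative of the concave function [x^b / (2 b)]. *)
Lemma vpot_axis (R : realType) (alpha : R) (j : nat) :
  0 <= alpha -> alpha < 1 ->
  vpot alpha (j.+2, 0)%N <= vpot alpha (j.+1, 0)%N + exit_prob alpha j.+1.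
Proof.
move=> a0 a1; have b0 : 0 < 1 - alpha by lra.
have x0 : 0 < j.+1%:R :> R by rewrite ltr0n.
have hp : 0 <= 1 - alpha <= 1 by apply/andP; split; lra.
rewrite /vpot /= !addn0 -(natr1 j.+1).
have := powR_succ_le x0 hp.
have -> : 1 - alpha - 1 = - alpha by ring.
rewrite powRN => h.
rewrite ler_pdivrMr ?mulr_gt0// mulrDl divfK ?mulf_neq0 ?pnatr_eq0 ?gt_eqF//.
apply: (le_trans h); rewrite lerD2l /exit_prob invfM le_eqVlt; apply/orP; left.
by apply/eqP; field; rewrite gt_eqF// powR_gt0.
Qed.

(** With [A], [B] the two values of [rad2] and [p = (1 - alpha) / 4], [(B / A)^p >= 1 + p ln (B / A)
    >= 1 + p (1 - A / B)]. *)
Lemma fpot_axis (R : realType) (alpha : R) (j : nat) : alpha < 1 ->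
  fpot alpha (j.+1, 0)%N * (1 + (1 - alpha) / 2 / (j.+1%:R + 2)) <=
  fpot alpha (j.+2, 0)%N.
Proof.
move=> a1; have b0 : 0 < 1 - alpha by lra.
rewrite /fpot mulrAC ler_wpM2r ?invr_ge0 ?sqrtr_ge0//.
have A0 := rad2_gt0 R (j.+1, 0)%N; have B0 := rad2_gt0 R (j.+2, 0)%N.
set A : R := rad2 R (j.+1, 0)%N in A0 *; set B : R := rad2 R (j.+2, 0)%N in B0 *.
have -> : B = A * (B / A) by field; rewrite gt_eqF.
rewrite powRM ?divr_ge0 ?(ltW A0) ?(ltW B0)// ler_wpM2l ?powR_ge0//.
rewrite {1}/powR gt_eqF ?divr_gt0//.
apply: le_trans (expR_ge1Dx _); rewrite lerD2l.
have -> : ln (B / A) = - ln (A / B) by rewrite !ln_div ?posrE// opprB.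
have h : ln (A / B) <= A / B - 1.
  have ab : 0 < A / B by rewrite divr_gt0.
  have -> : ln (A / B) = ln (1 + (A / B - 1)) by congr ln; ring.
  by apply: le_ln1Dx; lra.
(* With [B - A = 2 x + 1] this is [(2 x + 1) (x + 2) >= 2 B], an equality at [x = 1]: hence the [2]
   in the denominator. *)
have : 2 / (j.+1%:R + 2) <= 1 - A / B.
  have x1 : 1 <= j.+1%:R :> R by rewrite ler1n.
  have -> : 1 - A / B = (B - A) / B by field; rewrite gt_eqF.
  rewrite ler_pdivrMr ?ltr_wpDl// mulrAC ler_pdivlMr//.
  rewrite /A /B /rad2 /= -(natr1 j.+1); move: x1; set x : R := j.+1%:R => x1.
  by nra.
have e : (1 - alpha) / 2 / (j.+1%:R + 2) = (1 - alpha) / 4 * (2 / (j.+1%:R + 2)).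
  by field; rewrite gt_eqF// ltr_wpDl.
by rewrite e => h2; rewrite ler_pM2l ?divr_gt0//; lra.
Qed.

Lemma fpot_enter (R : realType) (alpha : R) (j : nat) : alpha < 1 ->
  fpot alpha (j.+1, 0)%N <= fpot alpha (j.+1, 1)%N.
Proof.
move=> a1; rewrite /fpot ler_wpM2r ?invr_ge0 ?sqrtr_ge0//.
rewrite ge0_ler_powR ?nnegrE ?(ltW (rad2_gt0 _ _))//; first by lra.
by rewrite /rad2 /= expr0n /= addr0 expr1n; lra.
Qed.

Lemma fpot_sqr (R : realType) (alpha : R) (z : state) : alpha < 1 ->
  fpot alpha z ^+ 2 = rad2 R z `^ ((1 - alpha) / 2) / (2 * (1 - alpha)).
Proof.
move=> a1; rewrite /fpot expr_div_n sqr_sqrtr; last by lra.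
rewrite -powR_mulrn ?powR_ge0// -powRrM; congr (_ `^ _ / _); by field.
Qed.

Lemma fpot_sqr_inner (R : realType) (alpha : R) (x y : nat) : alpha < 1 ->
  fpot alpha (x.+1, y.+1) ^+ 2 <= vpot alpha (x.+1, y.+1).
Proof.
move=> a1; rewrite fpot_sqr// /vpot ler_wpM2r ?invr_ge0//; first by lra.
have -> : 1 - alpha = 2%:R * ((1 - alpha) / 2) by field.
rewrite [in leRHS]powRrM powR_mulrn//.
have -> : 2%:R * ((1 - alpha) / 2) / 2 = (1 - alpha) / 2 by field.
rewrite ge0_ler_powR ?nnegrE ?(ltW (rad2_gt0 _ _)) ?sqr_ge0//; first by lra.
rewrite /rad2 /= natrD.
have x1 : 1 <= x.+1%:R :> R by rewrite ler1n.
have y1 : 1 <= y.+1%:R :> R by rewrite ler1n.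
by nra.
Qed.

Lemma fpot_sqr_axis_ge (R : realType) (alpha : R) (j : nat) : alpha < 1 ->
  vpot alpha (j.+1, 0)%N <= fpot alpha (j.+1, 0)%N ^+ 2.
Proof.
move=> a1; rewrite fpot_sqr// /vpot ler_wpM2r ?invr_ge0//; first by lra.
have -> : 1 - alpha = 2%:R * ((1 - alpha) / 2) by field.
rewrite powRrM powR_mulrn//.
have -> : 2%:R * ((1 - alpha) / 2) / 2 = (1 - alpha) / 2 by field.
rewrite ge0_ler_powR ?nnegrE ?(ltW (rad2_gt0 _ _)) ?sqr_ge0//; first by lra.
by rewrite /rad2 /= addn0 expr0n /= addr0; lra.
Qed.

Lemma fpot_sqr_axis_le (R : realType) (alpha : R) (j : nat) :
  0 <= alpha -> alpha < 1 ->
  fpot alpha (j.+1, 0)%N ^+ 2 <= vpot alpha (j.+1, 0)%N + 1.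
Proof.
move=> a0 a1.
have h : fpot alpha (j.+1, 0)%N ^+ 2 <= vpot alpha (j.+2, 0)%N.
  rewrite fpot_sqr// /vpot ler_wpM2r ?invr_ge0//; first by lra.
  have -> : 1 - alpha = 2%:R * ((1 - alpha) / 2) by field.
  rewrite [in leRHS]powRrM powR_mulrn//.
  have -> : 2%:R * ((1 - alpha) / 2) / 2 = (1 - alpha) / 2 by field.
  rewrite ge0_ler_powR ?nnegrE ?(ltW (rad2_gt0 _ _)) ?sqr_ge0//; first by lra.
  rewrite /rad2 /= addn0 expr0n /= addr0 -(natr1 j.+1).
  have x1 : 1 <= j.+1%:R :> R by rewrite ler1n.
  by nra.
apply: (le_trans h); apply: (le_trans (vpot_axis j a0 a1)).
by rewrite lerD2l; have := exit_prob_le12 j a0; lra.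
Qed.

(* AM-GM: [q g + f / (2 q) >= sqrt (2 g f)] with [q = sqrt (k + 1)]. *)
Lemma entry_gain_amgm (R : realType) (k g f theta : R) :
  0 <= k -> 0 <= g -> 0 <= f -> 0 <= theta <= 1 -> theta <= 2 * (g * f) ->
  theta * (k / (k + 1)) <=
  Num.sqrt k * g + (Num.sqrt (k + 1) - Num.sqrt k) * f.
Proof.
move=> k0 g0 f0 /andP[t0 t1] tgf.
set r := Num.sqrt k; set q := Num.sqrt (k + 1).
have r2 : r ^+ 2 = k by rewrite sqr_sqrtr.
have q2 : q ^+ 2 = k + 1 by rewrite sqr_sqrtr//; lra.
have r0 : 0 <= r by exact: sqrtr_ge0.
have q0 : 0 < q by rewrite sqrtr_gt0; lra.
have rq : r <= q by rewrite ler_sqrt; lra.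
set p := q^-1; have p0 : 0 < p by rewrite invr_gt0.
have pq : p * q = 1 by rewrite mulVf// gt_eqF.
(* Since [r / q >= r^2 / q^2], the factor [k / (k + 1)] pays for having [sqrt k] instead of
   [sqrt (k + 1)] in front of [g]. *)
have hr : k / (k + 1) * q <= r.
  rewrite mulrAC ler_pdivrMr; last by lra.
  have -> : k * q = r * q * r by rewrite -r2; ring.
  have -> : r * (k + 1) = r * q * q by rewrite -q2; ring.
  by rewrite ler_wpM2l// mulr_ge0// ltW.
have hq : p / 2 <= q - r.
  have h : (q - r) * (q + r) = 1.
    by have -> : (q - r) * (q + r) = q ^+ 2 - r ^+ 2; [ring | lra].
  have d0 : 0 <= q - r by lra.
  have h2 : 1 <= (q - r) * (2 * q) by rewrite -[leLHS]h ler_wpM2l//; lra.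
  have := ler_wpM2l (ltW p0) h2.
  have -> : p * ((q - r) * (2 * q)) = 2 * (q - r) * (p * q) by ring.
  by rewrite pq; lra.
set c := k / (k + 1) in hr *.
have c01 : 0 <= c <= 1.
  by apply/andP; split; [apply: divr_ge0 => //; lra | rewrite ler_pdivrMr; lra].
have key : theta <= q * g + p / 2 * f.
  rewrite -(@ler_pXn2r _ 2)// ?nnegrE; last first.
    by rewrite addr_ge0 ?mulr_ge0 ?divr_ge0// ltW.
  have -> : (q * g + p / 2 * f) ^+ 2 = (q * g - p / 2 * f) ^+ 2 + 2 * (g * f) * (p * q).
    by field.
  rewrite pq mulr1; have := sqr_ge0 (q * g - p / 2 * f).
  by nra.
have h1 : c * (q * g) <= r * g by rewrite mulrA ler_wpM2r.
have h2 : p / 2 * f <= (q - r) * f by rewrite ler_wpM2r.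
have h3 : 0 <= p / 2 * f by rewrite !mulr_ge0// ltW.
move: c01 => /andP[c0 c1].
have h4 : theta * c <= c * (q * g) + c * (p / 2 * f).
  by rewrite -mulrDr mulrC ler_wpM2l.
have h5 : c * (p / 2 * f) <= p / 2 * f by rewrite ler_piMl.
by lra.
Qed.

(** * Growth of [f sqrt k] on the axes *)

(** The expected one-step increment of [sqrt k * f] from the axis point [(j + 1, 0)]. *)
Definition entry_gain (R : realType) (alpha : R) (j k : nat) : R :=
  Num.sqrt k%:R * (1 - exit_prob alpha j.+1)
     * (fpot alpha (j.+2, 0)%N - fpot alpha (j.+1, 0)%N)
  + exit_prob alpha j.+1 * (Num.sqrt k.+1%:R * fpot alpha (j.+1, 1)%N
                            - Num.sqrt k%:R * fpot alpha (j.+1, 0)%N).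

Lemma fpot_axis_ge0 (R : realType) (alpha : R) (j : nat) :
  0 <= alpha -> alpha <= 2^-1 ->
  0 <= fpot alpha (j.+2, 0)%N - fpot alpha (j.+1, 0)%N.
Proof.
move=> a0 a12; have a1 : alpha < 1 by lra.
rewrite subr_ge0; apply: le_trans (fpot_axis j a1).
by rewrite ler_peMr ?(ltW (fpot_gt0 _ a1))// lerDl divr_ge0// ?addr_ge0//; lra.
Qed.

(** Dividing by the exit probability brings the gain to the form of [entry_gain_amgm], where [g] is
    the increment of [f] along the axis per unit of exit probability. *)
Lemma entry_gain_lower (R : realType) (alpha : R) (j k : nat) :
  0 <= alpha -> alpha <= 2^-1 ->
  exit_prob alpha j.+1 *
    (Num.sqrt k%:R * ((1 - exit_prob alpha j.+1)
        * (fpot alpha (j.+2, 0)%N - fpot alpha (j.+1, 0)%N)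
        / exit_prob alpha j.+1)
     + (Num.sqrt (k%:R + 1) - Num.sqrt k%:R) * fpot alpha (j.+1, 0)%N)
  <= entry_gain alpha j k.
Proof.
move=> a0 a12; have a1 : alpha < 1 by lra.
rewrite /entry_gain -(natr1 k).
have := exit_prob_gt0 alpha j; have := fpot_enter j a1.
have : 0 <= Num.sqrt (k%:R + 1) :> R by exact: sqrtr_ge0.
move: (exit_prob _ _) (fpot _ (j.+2, _)) (fpot _ (j.+1, 1%N)) (fpot _ _).
move: (Num.sqrt _) (Num.sqrt _) => r q h f' f1 f q0 f01 h0.
have -> : h * (r * ((1 - h) * (f' - f) / h) + (q - r) * f) =
  r * (1 - h) * (f' - f) + h * (q * f - r * f) by field; rewrite gt_eqF.
by rewrite lerD2l ler_wpM2l ?(ltW h0)// lerD2r ler_wpM2l.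
Qed.

Lemma entry_gain_ge0 (R : realType) (alpha : R) (j k : nat) :
  0 <= alpha -> alpha <= 2^-1 -> 0 <= entry_gain alpha j k.
Proof.
move=> a0 a12; have a1 : alpha < 1 by lra.
apply: le_trans (entry_gain_lower j k a0 a12).
have h0 := exit_prob_gt0 alpha j; have h12 := exit_prob_le12 j a0.
have f0 := ltW (fpot_gt0 (j.+1, 0)%N a1).
apply: mulr_ge0; first exact: ltW.
apply: addr_ge0; apply: mulr_ge0 => //.
  apply: divr_ge0; last exact: ltW.
  by apply: mulr_ge0; [lra | exact: fpot_axis_ge0].
by rewrite subr_ge0 ler_sqrt ?lerDl// addr_ge0.
Qed.

(** A discrete form of [(f^2)' = v' = exit_prob] on the axis; [x / (x + 2)] is the discretisation
    loss inherited from [fpot_axis]. *)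
Lemma fpot_increment (R : realType) (alpha : R) (j : nat) :
  0 <= alpha -> alpha <= 2^-1 ->
  exit_prob alpha j.+1 * (j.+1%:R / (j.+1%:R + 2)) <=
  2 * ((fpot alpha (j.+2, 0)%N - fpot alpha (j.+1, 0)%N) * fpot alpha (j.+1, 0)%N).
Proof.
move=> a0 a12; have a1 : alpha < 1 by lra.
have := fpot_axis j a1; have := fpot_sqr_axis_ge j a1; have := fpot_gt0 (j.+1, 0)%N a1.
rewrite /vpot /= addn0 /exit_prob.
have x0 : 0 < j.+1%:R :> R by rewrite ltr0n.
set x : R := j.+1%:R in x0 *.
set f := fpot _ (j.+1, _); set f' := fpot _ _; move=> f0 hf hf'.
have e : x `^ (1 - alpha) = x / x `^ alpha.
  by rewrite powRB ?(gt_eqF x0) ?implybT// powRr1// ltW.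
rewrite {}e in hf.
set P := x `^ alpha in hf *.
have P0 : 0 < P by rewrite powR_gt0.
set b := 1 - alpha in hf hf'; have b0 : 0 < b by rewrite /b; lra.
set t := (x + 2)^-1; have t0 : 0 < t by rewrite invr_gt0; lra.
have h1 : f * (b / 2 * t) <= f' - f by rewrite /t; lra.
have h2 : 2 * (f * (b / 2 * t) * f) <= 2 * ((f' - f) * f).
  by rewrite ler_pM2l// ler_wpM2r// ltW.
apply: le_trans h2.
have -> : 2 * (f * (b / 2 * t) * f) = b * t * f ^+ 2 by field.
have -> : (2 * P)^-1 * (x * t) = b * t * (x / P / (2 * b)).
  by field; rewrite !gt_eqF.
by rewrite ler_wpM2l// mulr_ge0// ltW.
Qed.

Lemma fpot_axis_linear (R : realType) (alpha : R) (j : nat) :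
  0 <= alpha -> alpha <= 2^-1 -> fpot alpha (j.+1, 0)%N <= j.+2%:R.
Proof.
move=> a0 a12; have a1 : alpha < 1 by lra.
rewrite -(@ler_pXn2r _ 2)// ?nnegrE ?(ltW (fpot_gt0 _ a1))//.
rewrite fpot_sqr//.
have x1 : 1 <= j.+1%:R :> R by rewrite ler1n.
have A1 : 1 <= rad2 R (j.+1, 0)%N.
  by rewrite /rad2 /= expr0n /= addr0; nra.
have h : rad2 R (j.+1, 0)%N `^ ((1 - alpha) / 2) <= rad2 R (j.+1, 0)%N.
  by rewrite ler1_powR//; lra.
rewrite ler_pdivrMr; last by lra.
apply: (le_trans h).
apply: (@le_trans _ _ (j.+2%:R ^+ 2)).
  rewrite /rad2 /= expr0n /= addr0 -(natr1 j.+1).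
  by nra.
by rewrite ler_peMr ?sqr_ge0//; lra.
Qed.

Lemma exit_prob_small (R : realType) (alpha delta : R) : 0 < alpha -> 0 < delta ->
  exists J : nat, forall j, (J <= j)%N -> exit_prob alpha j.+1 <= delta.
Proof.
move=> a0 d0; exists (Num.truncn (delta^-1 `^ alpha^-1)).+1 => j hj.
have h : delta^-1 `^ alpha^-1 <= j.+1%:R.
  by apply: (le_trans (ltW (truncnS_gt _))); rewrite ler_nat ltnW.
have h2 : delta^-1 <= j.+1%:R `^ alpha.
  have -> : delta^-1 = (delta^-1 `^ alpha^-1) `^ alpha.
    by rewrite -powRrM mulVf ?gt_eqF// powRr1// invr_ge0 ltW.
  by rewrite ge0_ler_powR ?nnegrE ?powR_ge0// ltW.
rewrite /exit_prob -[delta]invrK lef_pV2 ?posrE ?invr_gt0 ?mulr_gt0 ?powR_gt0//.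
by have : 0 < j.+1%:R `^ alpha by [rewrite powR_gt0]; lra.
Qed.

(** Uniformity in [j] takes two regimes. For [j >= J] AM-GM applies with three losses of [eps / 3],
    due to [h], [x / (x + 2)] and [k / (k + 1)]. For [j < J] the value of [f] is bounded and a large
    [sqrt k] alone makes [sqrt k * g >= 1]. *)
Lemma entry_gain_asymp (R : realType) (alpha eps : R) :
  0 < alpha -> alpha <= 2^-1 -> 0 < eps ->
  exists K : nat, forall j k, (K <= k)%N ->
  exit_prob alpha j.+1 * (1 - eps) <= entry_gain alpha j k.
Proof.
move=> a0 a12 e0; have a1 : alpha < 1 by lra.
have e3 : 0 < eps / 3 by lra.
have [J0 hJ0] := exit_prob_small a0 e3.
set J := maxn J0 (Num.truncn (6 / eps)).+1.
(* As [2 g f >= (1 - h) t >= 1/2 * 1/3], having [sqrt k >= 12 f] gives [sqrt k * g >= 1]. *)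
set K := maxn (12 * J.+1) (maxn (Num.truncn (3 / eps)).+1 1).
exists (K ^ 2)%N => j k hk.
have K1 : (0 < K)%N by rewrite /K !leq_max orbT.
have KK : (K <= K ^ 2)%N by rewrite -mulnn leq_pmulr.
have hk3 : 3 / eps <= k%:R.
  apply: (le_trans (ltW (truncnS_gt _))); rewrite ler_nat.
  by apply: leq_trans hk; apply: leq_trans KK; rewrite /K !leq_max leqnn !orbT.
have k0 : 0 < k%:R :> R by apply: lt_le_trans hk3; rewrite divr_gt0.
have hsk : 12 * J.+1%:R <= Num.sqrt k%:R :> R.
  rewrite -(@ler_pXn2r _ 2)// ?nnegrE ?sqrtr_ge0 ?mulr_ge0// sqr_sqrtr//.
  rewrite -natrM -natrX ler_nat; apply: leq_trans hk.
  by rewrite leq_exp2r// /K leq_max leqnn.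
have h0 := exit_prob_gt0 alpha j; have h12 := exit_prob_le12 j (ltW a0).
apply: le_trans (entry_gain_lower j k (ltW a0) a12).
rewrite ler_pM2l//.
have hinc := fpot_increment j (ltW a0) a12.
have D0 := fpot_axis_ge0 j (ltW a0) a12.
have f0 := fpot_gt0 (j.+1, 0)%N a1.
have fj := fpot_axis_linear j (ltW a0) a12.
have hh := hJ0 j.
move: h0 h12 hinc D0 f0 fj hh.
have : 1 <= j.+1%:R :> R by rewrite ler1n.
set x : R := j.+1%:R => x1.
move: (exit_prob _ _) (fpot _ (j.+1, _)) => h f h0 h12.
set D := _ - f => hinc D0 f0 fj hh.
set g := (1 - h) * D / h; set t := x / (x + 2) in hinc *.
have g0 : 0 <= g by rewrite /g !mulr_ge0// ?invr_ge0 ?(ltW h0)//; lra.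
have t01 : 3^-1 <= t <= 1.
  apply/andP; split; first by rewrite ler_pdivlMr; lra.
  by rewrite ler_pdivrMr; lra.
have /andP[t3 t1] := t01.
have tht : (1 - h) * t <= 2 * (g * f).
  have -> : 2 * (g * f) = (1 - h) / h * (2 * (D * f)).
    by rewrite /g; field; rewrite gt_eqF.
  have -> : (1 - h) * t = (1 - h) / h * (h * t) by field; rewrite gt_eqF.
  by rewrite ler_wpM2l// divr_ge0//; lra.
have [Jj|jJ] := leqP J j; last first.
  have fJ : f <= J.+1%:R by apply: (le_trans fj); rewrite ler_nat ltnS.
  have gJ : 1 <= Num.sqrt k%:R * g.
    have h1 : 12 * f <= Num.sqrt k%:R by lra.
    have := ler_wpM2r g0 h1.
    by nra.
  have : 0 <= (Num.sqrt (k%:R + 1) - Num.sqrt k%:R) * f.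
    rewrite mulr_ge0 ?(ltW f0)// subr_ge0 ler_sqrt ?lerDl// addr_ge0//.
  by lra.
have th1 : 0 <= (1 - h) * t <= 1.
  by apply/andP; split; [rewrite mulr_ge0; lra | nra].
apply: le_trans (entry_gain_amgm (ltW k0) g0 (ltW f0) th1 tht).
have hh3 : h <= eps / 3 by apply: hh; apply: leq_trans Jj; rewrite leq_maxl.
have hx : 6 / eps <= x.
  apply: (le_trans (ltW (truncnS_gt _))); rewrite ler_nat.
  by apply: ltnW; rewrite ltnS; apply: leq_trans Jj; rewrite leq_maxr.
have ht : 1 - eps / 3 <= t.
  rewrite ler_pdivlMr; last by lra.
  by move: hx; rewrite ler_pdivrMr//; nra.
set c : R := k%:R / (k%:R + 1).
have hc : 1 - eps / 3 <= c <= 1.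
  apply/andP; split; last by rewrite ler_pdivrMr; lra.
  rewrite ler_pdivlMr; last by lra.
  by move: hk3; rewrite ler_pdivrMr//; nra.
move: hc => /andP[hc c1].
have c0 : 0 <= c by rewrite divr_ge0; lra.
have s1 : 1 - 2 * (eps / 3) <= (1 - h) * t by nra.
have s2 : (1 - h) * t - eps / 3 <= (1 - h) * t * c by nra.
by lra.
Qed.

(** * The Lyapunov function and Chebyshev's inequality *)

(** The term [2 eps k] pays for the relative loss in [entry_gain_asymp]; [2 min (k, K)] pays for the
    first [K] entries, where the gain is only known to be nonnegative. *)
Definition lyapunov (R : realType) (alpha eps : R) (K : nat) (e : state * nat) : R :=
  vpot alpha e.1 + e.2%:R - 2 * Num.sqrt e.2%:R * fpot alpha e.1
  - 2 * eps * e.2%:R - 2 * (minn e.2 K)%:R.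

Lemma lyapunov_swap (R : realType) (alpha eps : R) (K x y k : nat) :
  lyapunov alpha eps K ((x, y), k) = lyapunov alpha eps K ((y, x), k).
Proof. by rewrite /lyapunov /= vpot_swap fpot_swap. Qed.

Lemma lyapunov_axis (R : realType) (alpha eps : R) (K j k : nat) :
  0 <= alpha -> alpha <= 2^-1 -> 0 < eps ->
  (forall j k, (K <= k)%N ->
    exit_prob alpha j.+1 * (1 - eps) <= entry_gain alpha j k) ->
  (1 - exit_prob alpha j.+1) * lyapunov alpha eps K ((j.+2, 0)%N, k)
    + exit_prob alpha j.+1 * lyapunov alpha eps K ((j.+1, 1)%N, k.+1) <=
  lyapunov alpha eps K ((j.+1, 0)%N, k).
Proof.
move=> a0 a12 e0 hK; have a1 : alpha < 1 by lra.
have hg : exit_prob alpha j.+1 * (1 - eps - ((minn k.+1 K)%:R - (minn k K)%:R))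
    <= entry_gain alpha j k.
  have [kK|kK] := leqP K k.
    have -> : minn k.+1 K = K by lia.
    by rewrite subrr subr0; exact: hK.
  have -> : minn k.+1 K = k.+1 by lia.
  apply: (@le_trans _ _ 0); last exact: entry_gain_ge0.
  rewrite -(natr1 k) mulr_ge0_le0 ?(ltW (exit_prob_gt0 _ _))//.
  by lra.
have hv := vpot_axis j a0 a1.
(* Both moves off the axis point raise [x + y] by one, so [v] rises equally in either case. *)
have e1 : vpot alpha (j.+1, 1)%N = vpot alpha (j.+2, 0)%N.
  by rewrite /vpot /= addn0 addn1.
rewrite /lyapunov /= e1; move: hg hv; rewrite /entry_gain -(natr1 k).
move: (exit_prob _ _) (vpot _ _) (vpot _ _) (fpot _ _) (fpot _ _) (fpot _ _).
move: (Num.sqrt _) (Num.sqrt _) (minn _ _)%:R (minn _ _)%:R => r q m m'.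
by move=> h v v' f f' f1; nra.
Qed.

Lemma transfer_lyapunov (R : realType) (alpha eps : R) (K N : nat)
    (e : state * nat) :
  0 <= alpha -> alpha <= 2^-1 -> 0 < eps ->
  (forall j k, (K <= k)%N ->
    exit_prob alpha j.+1 * (1 - eps) <= entry_gain alpha j k) ->
  reachable N e ->
  transfer alpha N (lyapunov alpha eps K) e <= lyapunov alpha eps K e.
Proof.
move=> a0 a12 e0 hK; have a1 : alpha < 1 by lra.
rewrite /transfer; case: ifP => // kN.
case: e kN => [[[|x] [|y]] k] kN re //.
- rewrite trans_sum_axis2 /estep !on_axes0l on_axes_inner /= addn0 addn1.
  rewrite !(@lyapunov_swap _ _ _ _ 0) (lyapunov_swap _ _ _ 1).
  exact: lyapunov_axis.
- rewrite trans_sum_axis1 /estep !on_axes0r on_axes_inner /= addn0 addn1.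
  exact: lyapunov_axis.
rewrite trans_sum_inner /estep on_axes_inner /= addn0.
have hf := fpot_inner x y a1; have hv := vpot_inner x y a0 a1.
have := ler_wpM2l (sqrtr_ge0 k%:R) hf.
by move: hv; rewrite /lyapunov /=; lra.
Qed.

Lemma lyapunov_lower (R : realType) (alpha eps : R) (K N : nat)
    (e : state * nat) :
  0 <= alpha -> alpha <= 2^-1 -> 0 < eps -> reachable N e ->
  (fpot alpha e.1 - Num.sqrt e.2%:R) ^+ 2 <=
  lyapunov alpha eps K e + 1 + 2 * eps * N%:R + 2 * K%:R.
Proof.
move=> a0 a12 e0 /andP[z0 kN]; have a1 : alpha < 1 by lra.
have hv : fpot alpha e.1 ^+ 2 <= vpot alpha e.1 + 1.
  case: e z0 {kN} => [[[|x] [|y]] k] //= _.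
  - by rewrite fpot_swap vpot_swap fpot_sqr_axis_le.
  - by rewrite fpot_sqr_axis_le.
  - by apply: (le_trans (fpot_sqr_inner x y a1)); rewrite lerDl.
have hm : (minn e.2 K)%:R <= K%:R :> R by rewrite ler_nat geq_minr.
have hk : eps * e.2%:R <= eps * N%:R by rewrite ler_pM2l// ler_nat.
have hs : Num.sqrt e.2%:R ^+ 2 = e.2%:R :> R by rewrite sqr_sqrtr.
have -> : (fpot alpha e.1 - Num.sqrt e.2%:R) ^+ 2 =
  fpot alpha e.1 ^+ 2 - 2 * Num.sqrt e.2%:R * fpot alpha e.1 + Num.sqrt e.2%:R ^+ 2.
  by ring.
by rewrite hs /lyapunov; lra.
Qed.

Definition deviates (R : realType) (alpha delta : R) (N : nat) (e : state * nat) : R :=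
  ((e.2 == N) && (delta * Num.sqrt N%:R < `|fpot alpha e.1 - Num.sqrt N%:R|))%:R.

(** Chebyshev's inequality. The Lyapunov function starts at [v (1, 1)], and [C] is chosen before
    [N], [n] and [delta], so dividing by [delta^2 N] leaves [2 eps / delta^2] in the limit. *)
Lemma iter_transfer_deviates (R : realType) (alpha eps : R) :
  0 < alpha -> alpha <= 2^-1 -> 0 < eps ->
  exists C : R, forall (N n : nat) (delta : R), 0 < delta ->
  delta ^+ 2 * N%:R * iter n (transfer alpha N) (deviates alpha delta N) ((1, 1)%N, 0%N)
  <= C + 2 * eps * N%:R.
Proof.
move=> a0 a12 e0.
have [K hK] := entry_gain_asymp a0 a12 e0.
exists (vpot alpha (1, 1)%N + 1 + 2 * K%:R) => N n delta d0.
have re : reachable N ((1, 1)%N, 0%N) by [].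
have [->|N0] := posnP N.
  rewrite mulr0 mul0r mulr0 addr0 addr_ge0 ?mulr_ge0// addr_ge0//.
  by rewrite /vpot divr_ge0 ?powR_ge0//; lra.
have dN : 0 < delta ^+ 2 * N%:R by rewrite mulr_gt0 ?exprn_gt0 ?ltr0n.
pose c : R := (delta ^+ 2 * N%:R)^-1.
have c0 : 0 <= c by rewrite invr_ge0 ltW.
have h e : reachable N e -> deviates alpha delta N e <=
    c * lyapunov alpha eps K e + c * (1 + 2 * eps * N%:R + 2 * K%:R).
  move=> re'; rewrite -mulrDr.
  have h1 := lyapunov_lower K (ltW a0) a12 e0 re'.
  have h0 := le_trans (sqr_ge0 _) h1.
  rewrite /deviates; case: eqP => [kN|_] /=; last by rewrite mulr_ge0//; lra.
  case: ltP => hd /=; last by rewrite mulr_ge0//; lra.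
  rewrite /c ler_pdivlMl// mulr1.
  apply: (@le_trans _ _ ((fpot alpha e.1 - Num.sqrt e.2%:R) ^+ 2)); last by lra.
  rewrite kN -[leRHS]real_normK ?num_real//.
  have -> : delta ^+ 2 * N%:R = (delta * Num.sqrt N%:R) ^+ 2.
    by rewrite exprMn sqr_sqrtr.
  by rewrite ler_pXn2r ?nnegrE ?mulr_ge0 ?sqrtr_ge0 ?(ltW d0)// ltW.
have := iter_transfer_le n (ltW a0) h re.
rewrite (iter_transfer_lin alpha N n c c (lyapunov alpha eps K)
  (fun=> 1 + 2 * eps * N%:R + 2 * K%:R)).
rewrite iter_transfer_cst -mulrDr {1}/c mulrC => h2.
rewrite -ler_pdivlMl//; apply: (le_trans h2).
rewrite mulrC ler_wpM2l//.
have h3 : iter n (transfer alpha N) (lyapunov alpha eps K) ((1, 1)%N, 0%N)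
    <= lyapunov alpha eps K ((1, 1)%N, 0%N).
  apply: iter_transfer_super => //; first exact: ltW.
  by move=> e' re'; apply: transfer_lyapunov => //; exact: ltW.
have : lyapunov alpha eps K ((1, 1)%N, 0%N) = vpot alpha (1, 1)%N.
  by rewrite /lyapunov /= sqrtr0 min0n; ring.
by lra.
Qed.

(** * Position at an entry *)

Lemma entry_next_to_axis (e : state * nat) (w : state) :
  e.1 != (0, 0)%N -> w \in nbrs e.1 -> on_axes e.1 -> ~~ on_axes w ->
  (w.1 == 1%N) || (w.2 == 1%N).
Proof.
case: e w => [[[|x] [|y]] k] [a b] //= _.
- rewrite !inE !xpair_eqE /on_axes /=; lia.
- rewrite !inE !xpair_eqE /on_axes /=; lia.
Qed.

(** The complementary event at the [N]-th entry, a coordinate equal to [1], is what lets the height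
    be read off from [rad2]. *)
Definition ill_shaped (R : realType) (N : nat) (e : state * nat) : R :=
  ((e.2 == N) && ~~ ((e.1.1 == 1%N) || (e.1.2 == 1%N)))%:R.

Lemma iter_transfer_ill_shaped (R : realType) (alpha : R) (N n : nat) :
  0 <= alpha ->
  iter n (transfer alpha N) (@ill_shaped R N) ((1, 1)%N, 0%N) <= 0.
Proof.
move=> a0.
have -> : 0 = ill_shaped R N ((1, 1)%N, 0%N) by rewrite /ill_shaped /= andbF.
apply: iter_transfer_super => // e /andP[z0 kN].
rewrite /transfer; case: ifP => // ltkN.
apply: (@le_trans _ _ 0); last by rewrite /ill_shaped ler0n.
rewrite big_seq big1// => w wn.
rewrite /ill_shaped /estep /=; case: eqP => /= [h|_]; last by rewrite mulr0.
have := entry_next_to_axis z0 wn.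
case: (on_axes e.1) h; case: (on_axes w) => /= h; try lia.
by move=> ->; rewrite // mulr0.
Qed.

(** * The times [rho] and the entry counter along a path *)

Lemma next_hitP (z : nat -> state) (A : pred state) (s e : nat) :
  next_hit z A (Some s) = Some e <->
  [/\ (s < e)%N, A (z e) & forall j, (s < j < e)%N -> ~~ A (z j)].
Proof.
rewrite /next_hit; case: pselect => [h|nh]; last first.
  by split => // -[se Ae _]; exfalso; apply: nh; exists e; rewrite se.
case: ex_minnP => m /andP[sm Am] mmin; split => [[<-]|[se Ae Aj]].
  split=> // j /andP[sj jm]; apply/negP => Aj.
  by have := mmin j; rewrite sj Aj => /(_ isT); lia.
congr Some; have me : (m <= e)%N by apply: mmin; rewrite se Ae.
apply/eqP; rewrite eqn_leq me /= leqNgt; apply/negP => lt_me.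
by have := Aj m; rewrite sm lt_me => /(_ isT); rewrite Am.
Qed.

Lemma next_hit_local (z z' : nat -> state) (A : pred state) (t : option nat) (e : nat) :
  (forall k, (k <= e)%N -> z k = z' k) ->
  next_hit z A t = Some e -> next_hit z' A t = Some e.
Proof.
case: t => // s zz' /next_hitP[se Ae Aj]; apply/next_hitP; split => //.
  by rewrite -zz'.
by move=> j /andP[sj je]; rewrite -zz' ?Aj ?sj ?(ltnW je).
Qed.

Lemma next_hit_gt (z : nat -> state) (A : pred state) (t : option nat) (e : nat) :
  next_hit z A t = Some e -> exists2 s, t = Some s & (s < e)%N.
Proof. by case: t => // s /next_hitP[se _ _]; exists s. Qed.

(** The stopping-time property in terms of paths; measurability of [rho] rests on it. *)
Lemma rho_local (z z' : nat -> state) (i m : nat) :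
  (forall k, (k <= m)%N -> z k = z' k) ->
  rho z i = Some m -> rho z' i = Some m.
Proof.
elim: i m => //= i IH m zz' h.
have [e he em] := next_hit_gt h; have [s hs se] := next_hit_gt he.
have zz'e k : (k <= e)%N -> z k = z' k by move=> ke; apply: zz'; lia.
have zz's k : (k <= s)%N -> z k = z' k by move=> ke; apply: zz'; lia.
have h1 := IH _ zz's hs.
rewrite h1; move: he; rewrite hs => /(next_hit_local zz'e) he'.
rewrite he'; move: h; rewrite hs.
have -> : next_hit z on_axes (Some s) = Some e.
  by apply: (next_hit_local _ he') => k ke; rewrite zz'e.
exact: next_hit_local.
Qed.

(* The position together with the number of entries into the interior so far,
   frozen when this number reaches [N]. *)
Fixpoint ext (z : nat -> state) (N n : nat) : state * nat :=
  if n is m.+1 then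
    let e := ext z N m in if (e.2 < N)%N then estep e (z m.+1) else e
  else (z 0%N, 0%N).

Lemma ext_le (z : nat -> state) (N n : nat) : ((ext z N n).2 <= N)%N.
Proof.
elim: n => //= n IH; case: ifP => // kN; rewrite /estep /=.
by case: (_ && _); lia.
Qed.

Lemma ext_running (z : nat -> state) (N n : nat) :
  ((ext z N n).2 < N)%N -> (ext z N n).1 = z n.
Proof. by case: n => //= n; case: ifP => [//|->]. Qed.

Lemma ext_local (z z' : nat -> state) (N n : nat) :
  (forall k, (k <= n)%N -> z k = z' k) -> ext z N n = ext z' N n.
Proof.
elim: n => [|n IH] zz' /=; first by rewrite zz'.
by rewrite IH ?zz'// => k kn; apply: zz'; lia.
Qed.

Lemma ext_iterE (z : nat -> state) (N n m : nat) : (ext z N m).2 = N ->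
  (m <= n)%N -> ext z N n = ext z N m.
Proof.
move=> h /subnK <-; elim: (n - m)%N => //= j ->.
by rewrite h ltnn.
Qed.

(* At time [n] exactly [k] entries into the interior have occurred: [rho_k] is
   [s] and, if the path is on the axes, [eta_(k+1)] is [e]. *)
Definition phase (z : nat -> state) (n k : nat) : Prop :=
  exists2 s, rho z k = Some s & (s <= n)%N /\
  if on_axes (z n) then
    exists e, [/\ next_hit z on_axes (Some s) = Some e, (e <= n)%N &
      forall j, (e <= j <= n)%N -> on_axes (z j)]
  else forall j, (s <= j <= n)%N -> ~~ on_axes (z j).

Lemma phase_entry (z : nat -> state) (n k : nat) : phase z n k ->
  on_axes (z n) -> ~~ on_axes (z n.+1) -> rho z k.+1 = Some n.+1.
Proof.
move=> [s hs [sn]] + an an1; rewrite an => -[e [he en hj]].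
rewrite /= hs he; apply/next_hitP; split => //=.
by move=> j jn; rewrite negbK; apply: hj; lia.
Qed.

Lemma phaseS (z : nat -> state) (n k : nat) : phase z n k ->
  phase z n.+1 (k + (on_axes (z n) && ~~ on_axes (z n.+1)))%N.
Proof.
move=> ph; have := phase_entry ph; move: ph.
move=> [s hs [sn]]; case: ifP => an.
  move=> [e [he en hj]] entry; case: (boolP (on_axes (z n.+1))) => an1 /=.
    rewrite addn0; exists s => //; split; first by lia.
    rewrite an1; exists e; split => //; first by lia.
    move=> j; rewrite [(j <= _)%N]leq_eqVlt => /andP[ej /orP[/eqP->//|jn]].
    by apply: hj; lia.
  rewrite addn1; exists n.+1; last first.
    split=> //; rewrite (negbTE an1) => j jn.
    by have -> : j = n.+1 by lia.
  exact: entry.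
move=> hj _ /=; rewrite addn0; exists s => //; split; first by lia.
case: (boolP (on_axes (z n.+1))) => an1.
  exists n.+1; split => //; last first.
    by move=> j jn; have -> : j = n.+1 by lia.
  by apply/next_hitP; split=> //= j jn; apply: hj; lia.
move=> j; rewrite [(j <= _)%N]leq_eqVlt => /andP[ej /orP[/eqP->//|jn]].
by apply: hj; lia.
Qed.

Lemma ext_phase (z : nat -> state) (N n : nat) : ~~ on_axes (z 0%N) ->
  ((ext z N n).2 < N)%N -> phase z n (ext z N n).2.
Proof.
move=> z0; elim: n => [|n IH] /=.
  move=> _; exists 0%N => //; split => //; rewrite (negbTE z0) => j.
  by rewrite -leqNgt leqn0 || case: j.
case: ifP => [kN _|->//].
by rewrite /estep /= (ext_running kN); apply: phaseS; exact: IH.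
Qed.

(** The counter reaches [N] at a step from an axis into the interior, which [phase_entry] identifies
    as [rho_N]. Starting off the axes matches [rho_0 = 0] with a zero count. *)
Lemma ext_rho (z : nat -> state) (N n : nat) : ~~ on_axes (z 0%N) ->
  (ext z N n).2 = N ->
  exists2 m, rho z N = Some m & z m = (ext z N n).1.
Proof.
move=> z0; elim: n => [/= <-|n IH /=]; first by exists 0%N.
case: ifP => [kN|_ /IH//]; rewrite /estep /=.
have ph := ext_phase z0 kN; rewrite (ext_running kN).
case: (boolP (_ && _)) => [/andP[an an1] hN|_ hN]; last by lia.
exists n.+1 => //; rewrite -hN addn1; exact: phase_entry ph an an1.
Qed.

(** * Events determined by finitely many positions *)

Definition pr d (T : measurableType d) (R : realType) (P : probability T R)
    (A : set T) : R := fine (P A).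

Lemma prE d (T : measurableType d) (R : realType) (P : probability T R)
    (A : set T) : measurable A -> P A = (pr P A)%:E.
Proof. by move=> mA; rewrite fineK// fin_num_measure. Qed.

Lemma pr_ge0 d (T : measurableType d) (R : realType) (P : probability T R)
    (A : set T) : 0 <= pr P A.
Proof. by rewrite fine_ge0. Qed.

Lemma pr_le d (T : measurableType d) (R : realType) (P : probability T R)
    (A B : set T) : measurable A -> measurable B -> A `<=` B -> pr P A <= pr P B.
Proof.
by move=> mA mB AB; rewrite -lee_fin -!prE// le_measure ?inE.
Qed.

Lemma pr_split d (T : measurableType d) (R : realType) (P : probability T R)
    (A B : set T) : measurable A -> measurable B ->
  pr P A = pr P (A `&` B) + pr P (A `&` ~` B).
Proof.
move=> mA mB; have mAB := measurableI _ _ mA mB.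
have mAC := measurableD mA mB; rewrite setDE in mAC.
apply: EFin_inj; rewrite EFinD -!prE//.
by rewrite (measureDI _ mA mB) addeC setDE.
Qed.

Lemma measurable_state (A : set state) : measurable (A : set (nat * nat)).
Proof.
have -> : A = \bigcup_(w : state) (if `[< A w >] then [set w] else set0).
  apply/seteqP; split => [w Aw|w [v _]].
    by exists w => //; rewrite asboolT.
  by case: asboolP => // Av ->.
apply: countable_bigcupT_measurable => [|[a b]]; first exact: countableP.
case: ifP => // _.
have -> : [set (a, b)] = [set a] `*` [set b].
  by apply/seteqP; split => [[x y] [-> ->]|[x y] /= [-> ->]].
exact: measurableX.
Qed.

Section chain.
Context d (T : measurableType d) (R : realType) (P : probability T R)
  (Z : nat -> {RV P >-> (nat * nat)%type}).

Lemma measurable_at (k : nat) (A : set state) : measurable [set t | A (Z k t)].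
Proof.
rewrite -[X in measurable X]setTI.
exact: (measurable_funPT (Z k)) measurableT _ (measurable_state A).
Qed.

Definition cylinder (m : nat) (z : nat -> state) : set T :=
  [set t | forall k, (k <= m)%N -> Z k t = z k].

Lemma measurable_cylinder (m : nat) (z : nat -> state) :
  measurable (cylinder m z).
Proof.
have -> : cylinder m z = \bigcap_(k in `I_m.+1) [set t | Z k t = z k].
  by apply/seteqP; split => t h k; have := h k.
apply: bigcap_measurableType => k _.
exact: (measurable_at k [set z k]).
Qed.

(** Such an event is a countable union of cylinders, indexed by finite sequences of states. *)
Lemma measurable_local (m : nat) (Q : (nat -> state) -> Prop) :
  (forall z z', (forall k, (k <= m)%N -> z k = z' k) -> Q z -> Q z') ->
  measurable [set t | Q (Z^~ t)].
Proof.
move=> hQ.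
pose F (s : seq state) : set T :=
  if `[< Q (nth (0, 0)%N s) >] then cylinder m (nth (0, 0)%N s) else set0.
have -> : [set t | Q (Z^~ t)] = \bigcup_s F s.
  apply/seteqP; split => [t Qt|t [s _]].
    have h k : (k <= m)%N -> Z k t = nth (0, 0)%N (mkseq (Z^~ t) m.+1) k.
      by move=> km; rewrite nth_mkseq.
    exists (mkseq (Z^~ t) m.+1) => //; rewrite /F asboolT//.
    exact: hQ Qt.
  rewrite /F; case: asboolP => // Qs h; apply: hQ Qs => k km.
  by rewrite h.
apply: countable_bigcupT_measurable => [|s]; first exact: countableP.
by rewrite /F; case: ifP => // _; exact: measurable_cylinder.
Qed.

Lemma pr_partition (k : nat) (s : seq state) (C : set T) : uniq s ->
  measurable C ->
  pr P C = \sum_(w <- s) pr P (C `&` [set t | Z k t = w])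
           + pr P (C `&` [set t | Z k t \notin s]).
Proof.
move=> us mC; elim: s us => [_|w s IH /= /andP[ws us]].
  rewrite big_nil add0r; congr pr; apply/seteqP; split => t //=.
  by case.
rewrite big_cons {1}(IH us) addrAC addrC; congr (_ + _).
have mw : measurable [set t | Z k t = w] by exact: (measurable_at k [set w]).
have ms : measurable (C `&` [set t | Z k t \notin s]).
  by apply: measurableI => //; exact: (measurable_at k [set v | v \notin s]).
rewrite (pr_split P ms mw); congr (pr P _ + pr P _); apply/seteqP; split => t /=.
- by case=> -[Ct _].
- by case=> Ct e; rewrite e.
- by case=> -[Ct ts] tw; split => //; rewrite inE negb_or ts andbT; apply/eqP.
- case=> Ct; rewrite inE negb_or => /andP[tw ts]; split => //.
  exact/eqP.
Qed.

End chain.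

(** * Comparison of the chain with the iterated operator *)

Lemma iter_transfer_stopped (R : realType) (alpha : R) (N n : nat)
    (f : state * nat -> R) (e : state * nat) : ~~ (e.2 < N)%N ->
  iter n (transfer alpha N) f e = f e.
Proof.
by move=> kN; elim: n => //= n IH; rewrite /transfer (negbTE kN).
Qed.

(** Induction on [n] for all cylinders at once: the next position splits a cylinder into longer
    ones, and the Markov property turns the sum over it into one application of [transfer]. *)
Lemma ext_prob_le d (T : measurableType d) (R : realType) (alpha : R)
    (P : probability T R) (Z : nat -> {RV P >-> (nat * nat)%type})
    (A : pred (state * nat)) (N n m : nat) (z : nat -> state) :
  0 <= alpha -> is_markov_chain (trans alpha) (1, 1)%N Z ->
  pr P (cylinder Z m z `&` [set t | A (ext (Z^~ t) N (m + n))]) <=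
  pr P (cylinder Z m z)
    * iter n (transfer alpha N) (fun e => (A e)%:R) (ext z N m).
Proof.
move=> a0 [_ mc].
have mC m' z' : measurable (cylinder Z m' z') by exact: measurable_cylinder.
have mE k : measurable [set t | A (ext (Z^~ t) N k)].
  apply: (@measurable_local _ _ _ _ Z k (fun z => A (ext z N k))) => z1 z2 h.
  by rewrite (ext_local N h).
have still m' z' (t : T) : cylinder Z m' z' t -> ext (Z^~ t) N m' = ext z' N m'.
  by move=> h; apply: ext_local.
have base m' z' k : (forall t, cylinder Z m' z' t -> ext (Z^~ t) N k = ext z' N m') ->
    pr P (cylinder Z m' z' `&` [set t | A (ext (Z^~ t) N k)]) <=
    pr P (cylinder Z m' z') * (A (ext z' N m'))%:R.
  move=> h; case: (boolP (A _)) => hA.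
    by rewrite mulr1 pr_le//; exact: measurableI.
  rewrite mulr0 (_ : _ `&` _ = set0) ?/pr ?measure0//.
  by rewrite -subset0 => t [/h e] /=; rewrite e (negbTE hA).
elim: n m z => [|n IH] m z.
  by rewrite addn0 /=; apply: base => t; exact: still.
have [kN|kN] := ltnP (ext z N m).2 N; last first.
  rewrite iter_transfer_stopped -?leqNgt//; apply: base => t /still e.
  have hN : (ext (Z^~ t) N m).2 = N.
    by rewrite e; apply/eqP; rewrite eqn_leq kN ext_le.
  by rewrite (ext_iterE hN) ?leq_addr.
have zm : (ext z N m).1 = z m := ext_running kN.
(* On a null cylinder the transition law says nothing, but both sides vanish. *)
have := pr_ge0 P (cylinder Z m z); rewrite le_eqVlt => /orP[/eqP C0|Cpos].
  rewrite -C0 mul0r [leRHS]C0 pr_le//; exact: measurableI.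
have Cneq : P (cylinder Z m z) != 0%E.
  by rewrite prE// eqe gt_eqF.
have step w : pr P (cylinder Z m z `&` [set t | Z m.+1 t = w]) =
    pr P (cylinder Z m z) * trans alpha (z m) w.
  have := mc m z w Cneq; rewrite /cond_prob -/(pr P _) -/(pr P _) setIC => <-.
  by rewrite mulrC divfK// gt_eqF.
have un := nbrs_uniq (z m).
(* The probabilities of the neighbours already sum to one, so no mass is left elsewhere. *)
have leave0 : pr P (cylinder Z m z `&` [set t | Z m.+1 t \notin nbrs (z m)]) = 0.
  have := pr_partition Z m.+1 un (mC m z).
  under eq_bigr do rewrite step.
  rewrite -mulr_sumr trans_sum1 mulr1 => h.
  by apply: (@addrI _ (pr P (cylinder Z m z))); rewrite addr0 -h.
set E := [set t | A (ext (Z^~ t) N (m + n.+1))].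
have mE' : measurable E by exact: mE.
rewrite (pr_partition Z m.+1 un (measurableI _ _ (mC m z) mE')).
have -> : pr P (cylinder Z m z `&` E `&` [set t | Z m.+1 t \notin nbrs (z m)]) = 0.
  apply/eqP; rewrite eq_le pr_ge0 andbT -leave0; apply: pr_le.
  - apply: measurableI; first exact: measurableI.
    exact: (measurable_at Z m.+1 [set v | v \notin nbrs (z m)]).
  - apply: measurableI => //.
    exact: (measurable_at Z m.+1 [set v | v \notin nbrs (z m)]).
  - by move=> t [[]].
rewrite addr0 iterS {1}/transfer kN zm mulr_sumr; apply: ler_sum => w _.
rewrite mulrA -step.
pose zw k := if k == m.+1 then w else z k.
have zwE k : (k <= m)%N -> zw k = z k by move=> km; rewrite /zw ltn_eqF.
have cylE : cylinder Z m z `&` [set t | Z m.+1 t = w] = cylinder Z m.+1 zw.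
  apply/seteqP; split => [t [h1 h2] k|t h].
    rewrite leq_eqVlt => /orP[/eqP->|]; first by rewrite /zw eqxx.
    by rewrite ltnS => km; rewrite zwE// h1.
  split => [k km|]; first by rewrite h ?zwE// ltnW.
  by have := h m.+1 (leqnn _); rewrite /zw eqxx.
have extE : estep (ext z N m) w = ext zw N m.+1.
  rewrite /= (ext_local N zwE).
  by rewrite kN /zw eqxx.
rewrite setIAC cylE extE /E -addSnnS; exact: IH.
Qed.

Lemma measurable_height_at d (T : measurableType d) (R : realType)
    (P : probability T R) (Z : nat -> {RV P >-> (nat * nat)%type})
    (i : nat) (B : pred nat) :
  measurable [set t | B (height_at (Z^~ t) (rho (Z^~ t) i))].
Proof.
pose F m := [set t | rho (Z^~ t) i = Some m].
have mF m : measurable (F m).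
  by apply: (@measurable_local _ _ _ _ Z m (fun z => rho z i = Some m)) => z z';
    exact: rho_local.
have -> : [set t | B (height_at (Z^~ t) (rho (Z^~ t) i))] =
    (\bigcup_m (F m `&` [set t | B (height (Z m t))]))
    `|` ((\bigcap_m ~` F m) `&` [set _ | B 0%N]).
  apply/seteqP; split => [t|t [[m _ [Fm]]|[Fn]]] /=.
  - case e : (rho _ i) => [m|] /= h; first by left; exists m.
    by right; split => // m _; rewrite /F /= e.
  - by rewrite Fm.
  - by case e : (rho _ i) => [m|] //= _; case: (Fn m).
apply: measurableU.
  apply: bigcupT_measurable => m; apply: measurableI => //.
  exact: (measurable_at Z m [set v | B (height v)]).
apply: measurableI.
  by apply: bigcapT_measurable => m; exact: measurableC.
case: (B 0%N).
- by rewrite (_ : [set _ | true] = setT)//; apply/seteqP.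
- by rewrite (_ : [set _ | false] = set0)//; apply/seteqP; split.
Qed.

(** If [rho_N] is later than [n] or infinite, the counter is still below [N] at time [n], and the
    first alternative covers this case whatever the default height is. *)
Lemma pr_height_le d (T : measurableType d) (R : realType) (alpha : R)
    (P : probability T R) (Z : nat -> {RV P >-> (nat * nat)%type})
    (B : pred nat) (N n : nat) :
  0 <= alpha -> is_markov_chain (trans alpha) (1, 1)%N Z ->
  pr P [set t | B (height_at (Z^~ t) (rho (Z^~ t) N))] <=
  iter n (transfer alpha N)
    (fun e => ((e.2 < N)%N || B (height e.1))%:R) ((1, 1)%N, 0%N).
Proof.
move=> a0 mc; set D := [set t | _].
have mD : measurable D by exact: measurable_height_at.
pose z : nat -> state := fun=> (1, 1)%N.
have mC : measurable (cylinder Z 0 z) by exact: measurable_cylinder.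
have C1 : pr P (cylinder Z 0 z) = 1.
  have [h _] := mc; rewrite /pr -[RHS]/(fine 1%E) -h; congr (fine (P _)).
  apply/seteqP; split => [t h'|t h' k]; first exact: h'.
  by rewrite leqn0 => /eqP ->.
(* The chain starts at [(1, 1)] only almost surely. *)
have CC0 : pr P (~` cylinder Z 0 z) = 0.
  have := pr_split P measurableT mC.
  rewrite !setTI C1 {1}/pr probability_setT /=.
  by move=> h; apply: (@addrI _ 1); rewrite addr0 -h.
rewrite (pr_split P mD mC).
have -> : pr P (D `&` ~` cylinder Z 0 z) = 0.
  apply/eqP; rewrite eq_le pr_ge0 andbT -CC0 pr_le//.
  - by apply: measurableI => //; exact: measurableC.
  - exact: measurableC.
pose A : pred (state * nat) := fun e => (e.2 < N)%N || B (height e.1).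
have mA k : measurable [set t | A (ext (Z^~ t) N k)].
  apply: (@measurable_local _ _ _ _ Z k (fun z => A (ext z N k))) => z1 z2 h.
  by rewrite (ext_local N h).
rewrite addr0; have := ext_prob_le A N n 0 z a0 mc.
rewrite C1 mul1r add0n; apply: le_trans.
apply: pr_le.
- exact: measurableI.
- exact: measurableI.
move=> t [Dt Ct]; split => //=; rewrite /A.
have [//|kN] /= := ltnP (ext (Z^~ t) N n).2 N.
have hN : (ext (Z^~ t) N n).2 = N by apply/eqP; rewrite eqn_leq kN ext_le.
have z0 : ~~ on_axes (Z 0%N t) by rewrite Ct.
have [m hm zm] := ext_rho z0 hN.
by move: Dt; rewrite /D /= hm /= -zm.
Qed.

(** * From [f] back to the height *)

Lemma rad2_height (R : realType) (z : state) : (z.1 == 1%N) || (z.2 == 1%N) ->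
  `|Num.sqrt (rad2 R z) - (height z)%:R| <= 1.
Proof.
move=> hz.
have {hz}[h1 h2] : (height z)%:R ^+ 2 <= rad2 R z <= ((height z)%:R + 1) ^+ 2 /\ True.
  split => //; case: z hz => x y /= /orP[/eqP->|/eqP->];
    rewrite /rad2 /height /= !expr1n; [case: y => [|y] | case: x => [|x]].
  - by rewrite maxn0 expr0n /=; apply/andP; split; lra.
  - rewrite (maxn_idPr _)//; have : 1 <= y.+1%:R :> R by rewrite ler1n.
    by set u : R := y.+1%:R => u1; apply/andP; split; nra.
  - by rewrite max0n expr0n /=; apply/andP; split; lra.
  - rewrite (maxn_idPl _)//; have : 1 <= x.+1%:R :> R by rewrite ler1n.
    by set u : R := x.+1%:R => u1; apply/andP; split; nra.
move: h1 => /andP[h1 h3].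
have h4 : (height z)%:R <= Num.sqrt (rad2 R z).
  by rewrite -(@ler_pXn2r _ 2)// ?nnegrE ?sqrtr_ge0// sqr_sqrtr// ltW// rad2_gt0.
have h5 : Num.sqrt (rad2 R z) <= (height z)%:R + 1.
  by rewrite -(@ler_pXn2r _ 2)// ?nnegrE ?sqrtr_ge0 ?addr_ge0// sqr_sqrtr// ltW// rad2_gt0.
by rewrite ler_norml; apply/andP; split; lra.
Qed.

(** Comparison with the fourth power, and [15 = 4 + 6 + 4 + 1]. The exponent in view is [2 / b], at
    most [4] because [alpha <= 1/2]. *)
Lemma powR_near1 (R : realType) (u p delta : R) : 0 <= p <= 4 -> 0 < u ->
  0 < delta <= 1 -> `|u - 1| <= delta -> `|u `^ p - 1| <= 15 * delta.
Proof.
move=> /andP[p0 p4] u0 /andP[d0 d1]; rewrite !ler_distl => /andP[h1 h2].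
have up : u `^ p <= (1 + delta) ^+ 4.
  apply: (@le_trans _ _ ((1 + delta) `^ p)).
    by rewrite ge0_ler_powR ?nnegrE ?(ltW u0)//; lra.
  by rewrite -powR_mulrn ?ler_powR//; lra.
have lo : (1 - delta) ^+ 4 <= u `^ p.
  have [->|dn] := eqVneq delta 1; first by rewrite subrr expr0n powR_ge0.
  have dlt : delta < 1 by rewrite lt_neqAle dn.
  apply: (@le_trans _ _ ((1 - delta) `^ p)).
    rewrite -powR_mulrn; last by lra.
    by rewrite ger_powR//; apply/andP; split; lra.
  by rewrite ge0_ler_powR ?nnegrE ?(ltW u0)//; lra.
have d2 : delta ^+ 2 <= delta by rewrite expr2 ler_piMl// ltW.
have d3 : delta ^+ 3 <= delta by rewrite exprS ler_piMr ?(ltW d0)//; lra.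
have d4 : delta ^+ 4 <= delta.
  by rewrite exprS ler_piMr ?(ltW d0)//; lra.
have e1 : (1 + delta) ^+ 4 = 1 + 4 * delta + 6 * delta ^+ 2 + 4 * delta ^+ 3 + delta ^+ 4.
  by ring.
have e2 : (1 - delta) ^+ 4 = 1 - 4 * delta + 6 * delta ^+ 2 - 4 * delta ^+ 3 + delta ^+ 4.
  by ring.
have := sqr_ge0 delta; have := sqr_ge0 (delta ^+ 2); rewrite -exprM => q4 q2.
by apply/andP; split; lra.
Qed.

Lemma height_concentrated (R : realType) (alpha eps : R) :
  0 <= alpha -> alpha <= 2^-1 -> 0 < eps ->
  exists2 delta : R, 0 < delta & exists N0 : nat, forall (N : nat) (z : state),
  (N0 <= N)%N -> (z.1 == 1%N) || (z.2 == 1%N) ->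
  `|fpot alpha z - Num.sqrt N%:R| <= delta * Num.sqrt N%:R ->
  `|(height z)%:R / N%:R `^ (1 - alpha)^-1
    - (2 * (1 - alpha)) `^ (1 - alpha)^-1| <= eps.
Proof.
move=> a0 a12 e0; set b := 1 - alpha; set c := (2 * b) `^ b^-1.
have b0 : 0 < b by rewrite /b; lra.
have c0 : 0 < c by rewrite powR_gt0// mulr_gt0.
(* This makes [15 delta c <= eps / 2]; the other half of [eps] absorbs the error of at most [1]
   between [sqrt rad2] and the height, divided by [M >= N]. *)
pose delta : R := Num.min 1 (eps / (30 * c)).
have d0 : 0 < delta by rewrite /delta lt_min ltr01 divr_gt0// mulr_gt0.
have d1 : 0 < delta <= 1 by rewrite d0 /delta ge_min lexx.
have dc : 15 * delta * c <= eps / 2.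
  have : delta <= eps / (30 * c) by rewrite /delta ge_min lexx orbT.
  by rewrite ler_pdivlMr ?mulr_gt0//; lra.
exists delta => //; exists (Num.truncn (2 / eps)).+1 => N z hN hz hf.
have N0 : 0 < N%:R :> R by rewrite ltr0n; apply: leq_trans hN.
have N1 : 1 <= N%:R :> R by rewrite ler1n; apply: leq_trans hN.
have hNe : 2 / eps <= N%:R.
  by apply: (le_trans (ltW (truncnS_gt _))); rewrite ler_nat.
set M := N%:R `^ b^-1.
have b1 : 1 <= b^-1 by rewrite invf_ge1//; rewrite /b; lra.
have MN : N%:R <= M.
  by rewrite -[leLHS]powRr1 ?(ltW N0)// /M ler_powR.
have M0 : 0 < M by apply: lt_le_trans MN.
have sN : 0 < Num.sqrt N%:R :> R by rewrite sqrtr_gt0.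
set u := fpot alpha z / Num.sqrt N%:R.
have a1 : alpha < 1 by lra.
have u0 : 0 < u by rewrite divr_gt0// fpot_gt0.
have hu : `|u - 1| <= delta.
  have -> : u - 1 = (fpot alpha z - Num.sqrt N%:R) / Num.sqrt N%:R.
    by rewrite /u; field; rewrite gt_eqF.
  by rewrite normrM normfV (gtr0_norm sN) ler_pdivrMr.
have hp : 0 <= 2 / b <= 4.
  by apply/andP; split; [rewrite divr_ge0// ltW | rewrite ler_pdivrMr// /b; lra].
have hup := powR_near1 hp u0 d1 hu.
(* Inverting [f = u sqrt N]: [sqrt rad2 = (f sqrt (2 b))^(2/b)], from which the limit constant [c]
   factors out. *)
have sE : Num.sqrt (rad2 R z) = u `^ (2 / b) * M * c.
  have A0 := rad2_gt0 R z.
  have s2b : 0 < Num.sqrt (2 * b) by rewrite sqrtr_gt0 mulr_gt0.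
  have e : rad2 R z `^ (b / 4) = u * Num.sqrt N%:R * Num.sqrt (2 * b).
    by rewrite /u /fpot -/b; field; rewrite !gt_eqF.
  have -> : Num.sqrt (rad2 R z) = (rad2 R z `^ (b / 4)) `^ (2 / b).
    rewrite -powRrM -(powR12_sqrt (ltW A0)); congr (_ `^ _).
    by field; rewrite gt_eqF.
  have sqrtP (v : R) : 0 < v -> Num.sqrt v `^ (2 / b) = v `^ b^-1.
    move=> v0; rewrite -(powR12_sqrt (ltW v0)) -powRrM; congr (_ `^ _).
    by field; rewrite gt_eqF.
  have uN0 : 0 <= u * Num.sqrt N%:R by rewrite mulr_ge0 ?sqrtr_ge0// ltW.
  rewrite e (powRM _ uN0 (sqrtr_ge0 _)) (powRM _ (ltW u0) (sqrtr_ge0 _)).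
  by rewrite (sqrtP _ N0) sqrtP// mulr_gt0.
have := rad2_height R hz; rewrite sE => hh.
have -> : (height z)%:R / M - c =
    (u `^ (2 / b) - 1) * c - (u `^ (2 / b) * M * c - (height z)%:R) / M.
  by field; rewrite gt_eqF.
apply: (le_trans (ler_normB _ _)); rewrite !normrM normfV (gtr0_norm c0) (gtr0_norm M0).
have t1 : `|u `^ (2 / b) - 1| * c <= 15 * delta * c by rewrite ler_wpM2r// ltW.
have t2 : `|u `^ (2 / b) * M * c - (height z)%:R| / M <= eps / 2.
  rewrite ler_pdivrMr//; apply: (le_trans hh).
  move: hNe; rewrite ler_pdivrMr// => hNe.
  by have := ler_wpM2l (ltW e0) MN; lra.
by lra.
Qed.

(** * Convergence in probability *)

Theorem proposition1p1 (R : realType) (alpha : R)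
    (d : measure_display) (T : measurableType d) (P : probability T R)
    (Z : nat -> {RV P >-> (nat * nat)%type}) :
  0 < alpha -> alpha < 2^-1 ->
  is_markov_chain (trans alpha) (1, 1)%N Z ->
  cvg_in_probability P
    (fun i t =>
       (height_at (Z^~ t) (rho (Z^~ t) i))%:R / i%:R `^ (1 - alpha)^-1)
    ((2 * (1 - alpha)) `^ (1 - alpha)^-1).
Proof.
move=> a0 a12 mc eps e0; have a0' := ltW a0; have a12' := ltW a12.
set c1 := _ `^ _.
pose B N : pred nat := fun h => eps < `|h%:R / N%:R `^ (1 - alpha)^-1 - c1|.
have mB N : measurable [set t | B N (height_at (Z^~ t) (rho (Z^~ t) N))].
  exact: measurable_height_at.
rewrite [X in X @ _ --> _](_ : _ = EFin \o
  (fun N => pr P [set t | B N (height_at (Z^~ t) (rho (Z^~ t) N))])); last first.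
  by apply: funext => N; rewrite /= -prE.
apply: cvg_EFin; first exact: nearW.
apply/cvgrPdist_le => eta eta0.
have [delta d0 [N0 hN0]] := height_concentrated a0' a12' e0.
have d2 : 0 < delta ^+ 2 * eta by rewrite mulr_gt0 ?exprn_gt0.
(* With this value [2 eps N] is a quarter of [delta^2 eta N]; [NC] below makes [C] at most another
   quarter. *)
have eps1 : 0 < delta ^+ 2 * eta / 8 by rewrite divr_gt0.
have [C hC] := iter_transfer_deviates a0 a12' eps1.
near=> N.
have NN0 : (N0 <= N)%N by near: N; exact: nbhs_infty_ge.
have Npos : (0 < N)%N by near: N; exact: nbhs_infty_gt.
have NC : 4 * C / (delta ^+ 2 * eta) <= N%:R by near: N; exact: nbhs_infty_ger.
rewrite /= sub0r normrN ger0_norm ?pr_ge0//.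
have re : reachable N ((1, 1)%N, 0%N) by [].
have eta2 : 0 < eta / 2 by rewrite divr_gt0.
(* The horizon [n] may depend on [N], since the probability bound holds for every [n]. *)
have [n hn] := running_vanishes a0' a12' eta2 re.
apply: (le_trans (pr_height_le (B N) N n a0' mc)).
(* Union bound: the entry is still to come, or [f] deviates, or the position is not next to an axis;
   otherwise [height_concentrated] excludes [B N]. *)
have h e : reachable N e -> ((e.2 < N)%N || B N (height e.1))%:R <=
    1 * running R N e + 1 * (1 * deviates alpha delta N e + 1 * ill_shaped R N e).
  move=> /andP[_ kN]; rewrite !mul1r /running.
  have [lt|ge] /= := ltnP e.2 N.
    by rewrite lerDl addr_ge0 /deviates /ill_shaped ?ler0n.
  have eN : e.2 == N by rewrite eqn_leq kN.
  rewrite add0r /deviates /ill_shaped eN /=.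
  case: (boolP (_ || _)) => [sh|_] /=; last first.
    by rewrite ler_wpDl ?ler0n// lern1; case: (B _ _).
  rewrite addr0 ler_nat; case: (boolP (B N _)) => // hB.
  rewrite lt0b ltNge; apply/negP => /(hN0 N _ NN0 sh).
  by rewrite leNgt; move: hB; rewrite /B => ->.
apply: (le_trans (iter_transfer_le n a0' h re)).
rewrite iter_transfer_lin iter_transfer_lin !mul1r.
have hill := @iter_transfer_ill_shaped R alpha N n a0'.
have hdev : iter n (transfer alpha N) (deviates alpha delta N) ((1, 1)%N, 0%N)
    <= eta / 2.
  have NR : 0 < delta ^+ 2 * N%:R by rewrite mulr_gt0 ?exprn_gt0 ?ltr0n.
  rewrite -(ler_pM2l NR); apply: (le_trans (hC N n delta d0)).
  move: NC; rewrite ler_pdivrMr//; lra.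
by lra.
Unshelve. all: by end_near.
Qed.
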